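(* Let $T>0$, $\alpha>\frac13$, and let $\zeta\in\mathcal C^{\alpha}([0,T];\mathbb R^d)$ be a path with $\zeta_0=0$ admitting a Lévy area $\zeta^2$ as described in the context. Assume that $b\in \mathcal C_b^{0,1}([0,T]\times\mathbb R^m;\mathbb R^m)$ and $\sigma\in \mathcal C_b^{1,2}([0,T]\times\mathbb R^m;\mathbb R^{m,d})$, and let $y\in\mathbb R^m$. Then for every $\kappa\in(\frac13,\alpha)$ there exists $x\in\mathcal Q_\zeta^\kappa([0,T];\mathbb R^m)$ with $x_0=y$ which solves $$x_t-x_s=\int_s^t b(u,x_u)\,du+\int_s^t\sigma(u,x_u)\,d\zeta_u\qquad\text{for all } 0\le s\le t\le T,$$ where the second integral is a rough integral of a weakly controlled path. If in addition $\sigma\in\mathcal C_b^{1,3}([0,T]\times\mathbb R^m;\mathbb R^{m,d})$, then the solution $x$ is also unique.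
   Context: Notation: $\delta f_{st}=f_t-f_s$ for paths $f$, and $\delta h_{sut}=h_{st}-h_{su}-h_{ut}$ for two-parameter functions $h$ on $\{s\le t\}$. $\mathcal C_1^\mu(V)$ is the space of $\mu$-Hölder paths on $[0,T]$ with values in $V$; $\mathcal C_2^\mu(V)$ is the space of $V$-valued continuous functions $h_{st}$, $s\le t$, vanishing for $s=t$, with $\sup_{s<t}|h_{st}|/|t-s|^\mu<\infty$. Repeated indices are summed. $\mathcal C_b^{k,l}$ denotes functions $f(t,x)$ with $k$ derivatives in time and $l$ in space: $\partial_t^i\partial_x^\beta f$ exist, are continuous and bounded for $i\le k$, $|\beta|\le l$. Assumption on $\zeta$: $\zeta\in\mathcal C_1^\alpha(\mathbb R^d)$, $\alpha>1/3$, $\zeta_0=0$, and there is $\zeta^2\in\mathcal C_2^{2\alpha}(\mathbb R^{d,d})$ with $\delta\zeta^{2;ij}_{sut}=\delta\zeta^i_{su}\,\delta\zeta^j_{ut}$ and $\zeta^{2;ij}_{st}+\zeta^{2;ji}_{st}=\delta\zeta^i_{st}\,\delta\zeta^j_{st}$. Weakly controlled paths: for $\kappa\le\alpha$ with $2\kappa+\alpha>1$, $\mathcal Q_\zeta^\kappa([0,T];\mathbb R^n)$ is the set of $z\in\mathcal C_1^\kappa(\mathbb R^n)$ (more precisely pairs $(z,z^\zeta)$) such that $\delta z^i_{st}=z_s^{\zeta;ii_1}\delta\zeta^{i_1}_{st}+\rho^i_{st}$ with $z^\zeta\in\mathcal C_1^\kappa(\mathbb R^{n,d})$ and $\rho\in\mathcal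 C_2^{2\kappa}(\mathbb R^n)$. Rough integral: for $\mu\in\mathcal Q_\zeta^\kappa(\mathbb R^d)$, $\int_s^t\mu_u^i\,d\zeta_u^i=\lim\sum_q\big[\mu^i_{t_q}\delta\zeta^i_{t_qt_{q+1}}+\mu^{\zeta;ii_1}_{t_q}\zeta^{2;i_1i}_{t_qt_{q+1}}\big]$, the limit being over partitions of $[s,t]$ with mesh tending to $0$. For $x\in\mathcal Q_\zeta^\kappa(\mathbb R^m)$, the path $(\sigma^{ik}(s,x_s))_{k}$ is regarded as weakly controlled with derivative $\partial_{x_j}\sigma^{ik}(s,x_s)\,x_s^{\zeta;jl}$.
   Formalization: κ is restricted to κ ≤ 1/2 (for κ > 1/2 existence fails: ζ=0, σ=0, b=1 gives remainder t−s, not in C_2^{2κ}), and a solution is a pair (x, x^ζ) with x^ζ_t = σ(t, x_t), without which uniqueness can fail. *)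

(* Defs.v *)
From HB Require Import structures.
From mathcomp Require Import all_boot all_order all_algebra.
From mathcomp Require Import all_classical all_reals all_analysis.

Set Implicit Arguments.
Unset Strict Implicit.
Unset Printing Implicit Defensive.

Import Order.TTheory GRing.Theory Num.Theory.
Import numFieldNormedType.Exports.

Local Open Scope classical_set_scope.
Local Open Scope ring_scope.

(* Paths on [0, T] are total functions on R, and functions on [0, T] x R^m are
   total functions R -> 'rV_m -> R; no definition below looks at their values
   outside of [0, T]. R^n carries the sup norm of 'rV[R]_n. *)

Section holder_spaces.
Context {R : realType} {V : normedModType R}.
Implicit Types (T mu : R) (f : R -> V) (h : R -> R -> V).

Definition incr f s t : V := f t - f s.

Definition incr2 h s u t : V := h s t - h s u - h u t.

Definition simplex T : set (R * R) := [set p | 0 <= p.1 <= p.2 /\ p.2 <= T].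

Definition C1 T mu f : Prop :=
  exists C : R, forall s t : R, 0 <= s -> s <= t -> t <= T ->
    `|incr f s t| <= C * (t - s) `^ mu.

Definition C2 T mu h : Prop :=
  [/\ {within simplex T, continuous (fun p : R * R => h p.1 p.2)},
      forall t : R, 0 <= t <= T -> h t t = 0
    & exists C : R, forall s t : R, 0 <= s -> s < t -> t <= T ->
        `|h s t| <= C * (t - s) `^ mu].

End holder_spaces.

Section Cb_spaces.
Context {R : realType} {m : nat}.
Implicit Types (T : R) (f : R -> 'rV[R]_m -> R) (j : 'I_m).

Definition slab T : set (R * 'rV[R]_m) := [set p | 0 <= p.1 <= T].

Definition bounded_continuous T f : Prop :=
  {within slab T, continuous (fun p : R * 'rV[R]_m => f p.1 p.2)} /\
  exists C : R, forall (t : R) x, 0 <= t <= T -> `|f t x| <= C.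

(* The difference quotient is restricted to times in [0, T], so that the time
   derivative is one-sided at 0 and at T. *)
Definition time_quotient f t x (s : R) : R := (f s x - f t x) / (s - t).

Definition time_derivable T f t x : Prop :=
  cvg (time_quotient f t x @ within [set s | 0 <= s <= T] t^').

Definition dtime T f t x : R :=
  lim (time_quotient f t x @ within [set s | 0 <= s <= T] t^').

Definition basis_vec j : 'rV[R]_m := delta_mx 0 j.

Definition dspace f j t x : R := 'D_(basis_vec j) (f t) x.

Fixpoint Cb_time T (k : nat) f : Prop :=
  bounded_continuous T f /\
  if k is k'.+1 then
    (forall (t : R) x, 0 <= t <= T -> time_derivable T f t x) /\
    Cb_time T k' (dtime T f)
  else True.

(* All d_t^i d_x^beta f with i <= k and |beta| <= l exist, are continuous and
   bounded on [0, T] x R^m; d_x^beta is an arbitrary word of length |beta| in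
   the partial derivatives. *)
Fixpoint Cb T (k l : nat) f : Prop :=
  Cb_time T k f /\
  if l is l'.+1 then
    forall j, (forall (t : R) x, 0 <= t <= T -> derivable (f t) x (basis_vec j)) /\
              Cb T k l' (dspace f j)
  else True.

End Cb_spaces.

Section rough.
Context {R : realType} {d : nat}.
Implicit Types (T alpha kappa : R).
Implicit Types (zeta : R -> 'rV[R]_d).

Definition Levy_area T alpha zeta (zeta2 : R -> R -> 'M[R]_d) : Prop :=
  [/\ C2 T (2 * alpha) zeta2,
      forall (s u t : R) (i j : 'I_d), 0 <= s -> s <= u -> u <= t -> t <= T ->
        incr2 zeta2 s u t i j = incr zeta s u 0 i * incr zeta u t 0 j
    & forall (s t : R) (i j : 'I_d), 0 <= s -> s <= t -> t <= T ->
        zeta2 s t i j + zeta2 s t j i = incr zeta s t 0 i * incr zeta s t 0 j].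

Definition remainder zeta n (z : R -> 'rV[R]_n) (z' : R -> 'M[R]_(n, d))
    (s t : R) : 'rV[R]_n :=
  \row_i (incr z s t 0 i - \sum_(l < d) z' s i l * incr zeta s t 0 l).

(* Elements of the space Q_zeta^kappa([0, T]; R^n) are the pairs (z, z'), where
   z' is the derivative of z with respect to zeta; z alone need not
   determine z'. *)
Definition controlled T kappa zeta n
    (z : R -> 'rV[R]_n) (z' : R -> 'M[R]_(n, d)) : Prop :=
  [/\ C1 T kappa z, C1 T kappa z' & C2 T (2 * kappa) (remainder zeta z z')].

(* For a partition s = t_0 < t_1 < ... < t_q = t, the list p is
   [:: t_1; ...; t_q]. *)
Definition rough_sum zeta (zeta2 : R -> R -> 'M[R]_d)
    (mu : R -> 'rV[R]_d) (mu' : R -> 'M[R]_d)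
    (s : R) (p : seq R) : R :=
  \sum_(0 <= q < size p)
    let u := nth s (s :: p) q in let v := nth s (s :: p) q.+1 in
    (\sum_(i < d) mu u 0 i * incr zeta u v 0 i +
     \sum_(i < d) \sum_(i1 < d) mu' u i i1 * zeta2 u v i1 i).

Definition is_rough_integral zeta (zeta2 : R -> R -> 'M[R]_d)
    (mu : R -> 'rV[R]_d) (mu' : R -> 'M[R]_d) (s t I : R) : Prop :=
  forall e : R, 0 < e -> exists2 eta : R, 0 < eta &
    forall p : seq R, itv_partition s t p ->
      (forall q, (q < size p)%N ->
         nth s (s :: p) q.+1 - nth s (s :: p) q < eta) ->
      `|rough_sum zeta zeta2 mu mu' s p - I| < e.

Context {m : nat}.
Implicit Types (b : R -> 'rV[R]_m -> 'rV[R]_m)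
  (sigma : R -> 'rV[R]_m -> 'M[R]_(m, d)).
Implicit Types (x : R -> 'rV[R]_m).

Definition sigma_path sigma x (i : 'I_m) (s : R) : 'rV[R]_d :=
  row i (sigma s (x s)).

Definition sigma_path' sigma x (x' : R -> 'M[R]_(m, d)) (i : 'I_m)
    (s : R) : 'M[R]_d :=
  \matrix_(k, l)
    \sum_(j < m) dspace (fun t w => sigma t w i k) j s (x s) * x' s j l.

(* The equation is an identity between elements (x, x') of Q_zeta^kappa: the
   rough integral of mu has derivative mu and the Lebesgue integral has
   derivative 0, whence x'_t = sigma(t, x_t). This does not follow from the
   equation for the increments of x: if zeta = 0, every x' is a derivative, and
   x still depends on x' when zeta2 is a nonzero antisymmetric area. *)
Definition solves T kappa zeta (zeta2 : R -> R -> 'M[R]_d) b sigma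
    x (x' : R -> 'M[R]_(m, d)) : Prop :=
  [/\ controlled T kappa zeta x x',
      forall i : 'I_m,
        controlled T kappa zeta (sigma_path sigma x i)
          (sigma_path' sigma x x' i),
      forall t : R, 0 <= t <= T -> x' t = sigma t (x t)
    & forall (s t : R) (i : 'I_m), 0 <= s -> s <= t -> t <= T ->
        exists2 I : R,
          is_rough_integral zeta zeta2 (sigma_path sigma x i)
            (sigma_path' sigma x x' i) s t I &
          x t 0 i - x s 0 i =
            (\int[lebesgue_measure]_(u in `[s, t]) b u (x u) 0 i) + I].

End rough.

(* Main.v *)
Require Import Defs.
From HB Require Import structures.
From mathcomp Require Import all_boot all_order all_algebra.
From mathcomp Require Import all_classical all_reals all_analysis.
From mathcomp Require Import zify ring lra.

Set Implicit Arguments.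
Unset Strict Implicit.
Unset Printing Implicit Defensive.

Import Order.TTheory GRing.Theory Num.Theory.
Import numFieldNormedType.Exports.

Local Open Scope classical_set_scope.
Local Open Scope ring_scope.

(** The proof follows Davie's discrete approach to rough equations. For s <= t
put
  step s t xi = int_s^t b(u, xi) du + sigma(s, xi) dzeta_st
                + (D sigma . sigma)(s, xi) zeta2_st,
the one-step expansion of a solution that starts from xi at time s, and let
theta = 3 kappa > 1. Solving the equation with x'_t = sigma(t, x_t) amounts to
  |x_t - x_s - step s t x_s| <= C (t - s)^theta.
Indeed x_t - int_0^t b(u, x_u) du is then a path whose increments differ from
the compensated increments of the rough sums by O((t - s)^theta), and since
theta > 1 these errors vanish when they are added along a fine partition
([local_is_rough_integral]). Conversely a limit of rough sums stays within
O((t - s)^theta) of a single compensated increment, by a sewing argument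
([rough_integral_local]).

The estimate on which everything rests is that step nearly composes: if eta is
within (t - s)^(2 kappa) of xi + step s u xi, then
step s u xi + step u t eta - step s t xi is O((t - s)^theta). By Chen's
relation the rough part of this expression is the remainder of a first-order
expansion of sigma, of size (t - s)^(2 kappa), against dzeta_ut, plus an
increment of D sigma . sigma, of size (t - s)^kappa, against zeta2_ut
([rough_germ_defect], [davie_step_defect]).

Existence. Along any finite set of times the Euler scheme
x_(k+1) = x_k + step x_k satisfies the above bound between any two of its times
at distance at most delta, with C and delta independent of the set
([discrete_sewing], [euler_local]). Each such bound is a closed condition on
the values of a path at two times, and the values stay in a fixed ball, so
Tychonoff's theorem provides one path that satisfies all of them at once
([pointwise_compactness], [davie_solution]). No contraction is involved, which
is why two space derivatives of sigma are enough.

Uniqueness. With three space derivatives the composition defects of two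
solutions x and z differ by O(E (t - s)^theta) when |x - z| <= E
([rough_germ_defect_difference]). Starting from a time where the solutions
agree, this improves, on an interval of a fixed length, any pair of bounds
|x - z| <= E and |remainder of x - remainder of z| <= A E (t - s)^theta by a
factor less than 1; iterating shows that x = z on this interval
([solutions_agree_locally]), and finitely many such intervals cover [0, T].

Constants are handled by the relation f <~ g, which says that f is bounded by a
constant multiple of g. The variables of an estimate (times, points, bounds)
are functions on an arbitrary type X, so that the uniformity of the constant in
all of these variables is the uniformity over X; a bound with explicit
quantifiers is recovered by choosing for X the type of all admissible tuples. *)

(** * Bounds up to a constant *)

Definition lesssim {R : realType} {X : Type} (f g : X -> R) :=
  exists2 C, 0 <= C & forall x, `|f x| <= C * g x.

Notation "f <~ g" := (lesssim f g) (at level 70, no associativity).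

Section lesssim_theory.
Context {R : realType} {X : Type}.
Implicit Types (f g h a b : X -> R).

Lemma lesssim_le f g : (forall x, `|f x| <= g x) -> f <~ g.
Proof. by move=> fg; exists 1 => // x; rewrite mul1r. Qed.

Lemma lesssim_refl f : (forall x, 0 <= f x) -> f <~ f.
Proof. by move=> f0; apply: lesssim_le => x; rewrite ger0_norm. Qed.

Lemma lesssim_trans g f h : f <~ g -> g <~ h -> f <~ h.
Proof.
move=> [C C0 fg] [D D0 gh]; exists (C * D); first exact: mulr_ge0.
move=> x; apply: le_trans (fg x) _; rewrite -mulrA ler_wpM2l//.
exact: le_trans (ler_norm _) (gh x).
Qed.

Lemma lesssim_ext g f a : (forall x, g x = f x) -> f <~ a -> g <~ a.
Proof. by move=> fg [C C0 fa]; exists C => // x; rewrite fg. Qed.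

Lemma lesssim_extr b f a : (forall x, b x = a x) -> f <~ a -> f <~ b.
Proof. by move=> fg [C C0 fa]; exists C => // x; rewrite fg. Qed.

Lemma lesssim_norm f g : f <~ g -> (fun x => `|f x|) <~ g.
Proof. by move=> [C C0 fg]; exists C => // x; rewrite normr_id. Qed.

Lemma lesssimD f g a : f <~ a -> g <~ a -> (fun x => f x + g x) <~ a.
Proof.
move=> [C C0 fa] [D D0 ga]; exists (C + D); first exact: addr_ge0.
by move=> x; rewrite mulrDl (le_trans (ler_normD _ _))// lerD.
Qed.

Lemma lesssimN f a : f <~ a -> (fun x => - f x) <~ a.
Proof. by move=> [C C0 fa]; exists C => // x; rewrite normrN. Qed.

Lemma lesssimB f g a : f <~ a -> g <~ a -> (fun x => f x - g x) <~ a.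
Proof. by move=> fa /lesssimN; exact: lesssimD. Qed.

Lemma lesssimM f g a b : f <~ a -> g <~ b ->
  (fun x => f x * g x) <~ (fun x => a x * b x).
Proof.
move=> [C C0 fa] [D D0 ga]; exists (C * D); first exact: mulr_ge0.
by move=> x; rewrite normrM mulrACA ler_pM.
Qed.

(** The index set is finite, so the constants can be added up. *)
Lemma lesssim_sum n (F : 'I_n -> X -> R) a : (forall x, 0 <= a x) ->
  (forall i, F i <~ a) -> (fun x => \sum_(i < n) F i x) <~ a.
Proof.
move=> a0 Fa; elim: n F Fa => [|n IH] F Fa.
  by exists 0 => // x; rewrite big_ord0 normr0 mul0r.
apply: (@lesssim_ext _ (fun x => (\sum_(i < n) F (widen_ord (leqnSn n) i) x)
   + F ord_max x)); first by move=> x; rewrite big_ord_recr.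
by apply: lesssimD => //; exact: (IH (fun i => F (widen_ord (leqnSn n) i))).
Qed.

Lemma lesssimMl f g a : f <~ (fun=> 1) -> g <~ a -> (fun x => f x * g x) <~ a.
Proof.
by move=> f1 ga; apply: lesssim_extr (lesssimM f1 ga) => x; rewrite mul1r.
Qed.

Lemma lesssimMr f g a : f <~ a -> g <~ (fun=> 1) -> (fun x => f x * g x) <~ a.
Proof.
by move=> f1 ga; apply: lesssim_extr (lesssimM f1 ga) => x; rewrite mulr1.
Qed.

Lemma lesssim_mx m n (v : X -> 'M[R]_(m, n)) a : (forall x, 0 <= a x) ->
  (forall i j, (fun x => v x i j) <~ a) -> (fun x => `|v x|) <~ a.
Proof.
move=> a0 va.
have [|C C0 H] := @lesssim_sum m
    (fun i x => \sum_(j < n) `|v x i j|) a a0.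
  by move=> i; apply: lesssim_sum => // j; exact: lesssim_norm.
exists C => // x; rewrite normr_id.
have Cax := mulr_ge0 C0 (a0 x).
rewrite [leLHS]mx_normrE; apply: bigmax_le => // -[i j] _ /=.
apply: le_trans (H x) => /=; apply: le_trans (ler_norm _).
have S0 k : 0 <= \sum_(j0 < n) `|v x k j0| by apply: sumr_ge0.
rewrite (bigD1 i)//= (bigD1 j)//= -addrA lerDl addr_ge0//.
  by apply: sumr_ge0.
by apply: sumr_ge0.
Qed.

End lesssim_theory.

Lemma coord_le_norm {R : realType} m n (M : 'M[R]_(m, n)) i j : `|M i j| <= `|M|.
Proof.
rewrite [leRHS]mx_normrE.
exact: (le_bigmax _ (fun ij : 'I_m * 'I_n => `|M ij.1 ij.2|) (i, j)).
Qed.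

Lemma mx_norm_le {R : realType} m n (M : 'M[R]_(m, n)) (c : R) :
  0 <= c -> (forall i j, `|M i j| <= c) -> `|M| <= c.
Proof.
by move=> c0 H; rewrite [leLHS]mx_normrE; apply: bigmax_le.
Qed.

(** * Sewing along a sequence of times *)

Section sewing.
Context {R : realType} (theta : R) (theta_gt1 : 1 < theta).

(** Halving an interval turns h^theta into two terms whose sum is this fraction
    of h^theta; sewing works because the fraction is below 1 exactly when
    theta > 1. *)
Definition sewing_ratio : R := 2 `^ (1 - theta).

Lemma sewing_ratio_gt0 : 0 < sewing_ratio. Proof. exact: powR_gt0. Qed.

Lemma sewing_ratio_lt1 : sewing_ratio < 1.
Proof.
rewrite /sewing_ratio -opprB powRN invf_lt1 ?powR_gt0//.
have t0 : theta - 1 > 0 by rewrite subr_gt0.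
rewrite lt_neqAle eq_sym powR_eq1 (gt_eqF t0) orbF negb_or -leNgt ler0n andbT.
rewrite (eqr_nat R 2 1) /= -[X in X <= _](powRr0 2).
by apply: ler_powR; [rewrite ler1n|exact: ltW].
Qed.

Lemma powR_half (h : R) : 0 <= h ->
  2 * (h / 2) `^ theta = sewing_ratio * h `^ theta.
Proof.
move=> h0; rewrite powRM// ?invr_ge0// /sewing_ratio powRB; last first.
  by rewrite pnatr_eq0 /= implybT.
rewrite powRr1// -powR_inv1// -powRrM mulN1r powRN.
by ring.
Qed.

(** The splitting point of the sewing induction: the last index before l within
    h of the start. When h is half of the total length, both [k, m] and [m +
    1, l] have at most half of the length, whatever the spacing of the
    times. *)
Lemma split_nondecreasing (t : nat -> R) (h : R) (k l : nat) :
  nondecreasing_seq t -> 0 <= h -> (k < l)%N ->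
  exists m, [/\ (k <= m)%N, (m < l)%N, t m - t k <= h &
    (m.+1 < l)%N -> h < t m.+1 - t k].
Proof.
move=> nt h0 kl.
pose P m := [&& (k <= m)%N, (m < l)%N & t m - t k <= h].
have exP : exists m, P m by exists k; rewrite /P leqnn kl subrr h0.
have bP m : P m -> (m <= l)%N by case/and3P => _ /ltnW.
case: (ex_maxnP exP bP) => m /and3P[km ml tm] mx; exists m; split => // m1l.
rewrite ltNge; apply/negP => H.
by have := mx m.+1; rewrite /P H m1l (leqW km) ltnn => /(_ isT).
Qed.

(** The solution C of C = sewing_ratio * C + 2 * K: cutting an interval into two
    halves and a single step costs two defects. *)
Definition sewing_constant (K : R) : R := 2 * K / (1 - sewing_ratio).

Lemma sewing_constant_ge0 K : 0 <= K -> 0 <= sewing_constant K.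
Proof.
move=> K0; apply: divr_ge0; first exact: mulr_ge0.
by rewrite subr_ge0 ltW// sewing_ratio_lt1.
Qed.

(** An almost additive quantity that vanishes on single steps is small on all
    intervals. The bound on [k, m] may be used in the proof of almost
    additivity: in the Euler scheme the defect is only controlled once the
    scheme is known to be close to its one-step expansion on the first part
    of the interval. *)
Lemma discrete_sewing (t : nat -> R) (A : nat -> nat -> R) (K delta : R) :
  nondecreasing_seq t -> 0 <= K ->
  (forall k, A k k <= 0) -> (forall k, A k k.+1 <= 0) ->
  (forall k m l, (k <= m)%N -> (m <= l)%N -> t l - t k <= delta ->
     A k m <= sewing_constant K * (t m - t k) `^ theta ->
     A k l <= A k m + A m l + K * (t l - t k) `^ theta) ->
  forall k l, (k <= l)%N -> t l - t k <= delta ->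
    A k l <= sewing_constant K * (t l - t k) `^ theta.
Proof.
move=> nt K0 A0 A1 step k l.
set C := sewing_constant K; have C0 : 0 <= C := sewing_constant_ge0 K0.
have Cpos a b : 0 <= C * (t a - t b) `^ theta by rewrite mulr_ge0 ?powR_ge0.
have [n] := ubnP (l - k)%N; elim: n k l => // n IH k l kln kl tkl.
have [->|kl1] := eqVneq k l; first exact: le_trans (A0 _) _.
have {}kl : (k < l)%N by rewrite ltn_neqAle kl1.
have [h hE] : exists h, h = t l - t k by exists (t l - t k).
have h0 : 0 <= h by rewrite hE subr_ge0 nt// ltnW.
have hC : C = sewing_ratio * C + 2 * K.
  have : 1 - sewing_ratio != 0 by rewrite subr_eq0 gt_eqF// sewing_ratio_lt1.
  by rewrite /C /sewing_constant => ?; field.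
have mono (a : R) : 0 <= a -> a <= h / 2 ->
    a `^ theta <= (h / 2) `^ theta.
  move=> a0 ah; apply: ge0_ler_powR => //; rewrite ?nnegrE//.
    by rewrite ltW// (lt_trans _ theta_gt1).
  exact: le_trans ah.
have half : C * (h / 2) `^ theta + C * (h / 2) `^ theta =
    sewing_ratio * C * h `^ theta.
  by rewrite -mulrA mulrCA -powR_half//; ring.
(* Cut at m and m + 1; the step in between contributes nothing. *)
have [m [km ml tm tm1]] := split_nondecreasing nt (divr_ge0 h0 (ler0n _ 2)) kl.
have tkm : t k <= t m by exact: nt.
have tml : t m <= t l by apply: nt; exact: ltnW.
have IHkm : A k m <= C * (t m - t k) `^ theta.
  apply: IH => //; first by clear -kln km ml; lia.
  by apply: le_trans tkl; rewrite lerD2r.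
have halfkm : A k m <= C * (h / 2) `^ theta.
  by apply: le_trans IHkm _; rewrite ler_wpM2l// mono// subr_ge0.
have Kh0 : 0 <= K * h `^ theta by rewrite mulr_ge0 ?powR_ge0.
have Ch0 : 0 <= C * (h / 2) `^ theta by rewrite mulr_ge0 ?powR_ge0.
rewrite -hE hC mulrDl -half -mulrA mulr_natl mulr2n.
have [m1l|] := ltnP m.+1 l; last first.
  move=> lm; have {}lm : l = m.+1 by apply/eqP; rewrite eqn_leq lm ml.
  have := step k m l km (ltnW ml) tkl IHkm; rewrite -hE => /le_trans; apply.
  move: (A1 m); rewrite -lm => Aml.
  rewrite [leRHS]addrA lerD2r; apply: lerD; last exact: le_trans Kh0.
  by apply: le_trans halfkm _; rewrite lerDl.
have tm1l : t m.+1 <= t l by apply: nt; exact: ltnW.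
have tkm1 : t k <= t m.+1 by apply: nt; exact: leqW.
have A1' : A k m.+1 <= C * (t m.+1 - t k) `^ theta.
  apply: IH; [|exact: leqW|by apply: le_trans tkl; rewrite lerD2r].
  by clear -kln km m1l; lia.
have A2 : A m.+1 l <= C * (h / 2) `^ theta.
  apply: le_trans (_ : _ <= C * (t l - t m.+1) `^ theta) _.
    apply: IH; [|exact: ltnW|by apply: le_trans tkl; rewrite lerB].
    by clear -kln km m1l; lia.
  rewrite ler_wpM2l// mono//; first by rewrite subr_ge0.
  have := tm1 m1l; rewrite hE; clear; lra.
have S1 : A k m.+1 <= A k m + A m m.+1 + K * h `^ theta.
  apply: le_trans (step k m m.+1 km (leqnSn _) _ IHkm) _.
    by apply: le_trans tkl; rewrite lerD2r.
  rewrite lerD2l ler_wpM2l// ge0_ler_powR ?nnegrE ?subr_ge0//.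
    by rewrite ltW// (lt_trans _ theta_gt1).
  by rewrite hE lerD2r.
have := step k m.+1 l (leqW km) (ltnW m1l) tkl A1'; rewrite -hE.
move=> S2; apply: le_trans S2 _; rewrite [leRHS]addrA lerD2r.
rewrite [leRHS]addrAC; apply: lerD => //; apply: le_trans S1 _.
by rewrite lerD2r -[leRHS]addr0; exact: lerD.
Qed.

End sewing.

(** * Mean value estimates *)

Lemma common_bound {R : realType} n (P : 'I_n -> R -> Prop) :
  (forall j c c', c <= c' -> P j c -> P j c') ->
  (forall j, exists C, P j C) -> exists2 C, 0 <= C & forall j, P j C.
Proof.
move=> mono ex; have [c Pc] := choice ex.
exists (\sum_(j < n) `|c j|); first by apply: sumr_ge0.
move=> j; apply: mono (Pc j); rewrite (bigD1 j)//=.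
by rewrite (le_trans (ler_norm _))// lerDl; apply: sumr_ge0.
Qed.

Section mean_value.
Context {R : realType} {m : nat}.
Implicit Types (g : 'rV[R]_m -> R) (x y z e : 'rV[R]_m).

Lemma is_derive_line g z e (tau : R) : derivable g (z + tau *: e) e ->
  is_derive tau 1 (fun t => g (z + t *: e)) ('D_e g (z + tau *: e)).
Proof.
move=> dg.
have E : (fun h : R => h^-1 *: (((fun t => g (z + t *: e)) \o shift tau) (h *: 1)
    - g (z + tau *: e))) =
  (fun h : R => h^-1 *: ((g \o shift (z + tau *: e)) (h *: e)
    - g (z + tau *: e))).
  apply/funext => h /=; congr (_ *: (g _ - _)).
  by rewrite scalerDl addrCA /GRing.scale/= mulr1.
by apply: DeriveDef; rewrite ?/derivable ?/derive E.
Qed.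

(** Comparison with the linear function of slope c, so that the same statement
    gives Lipschitz bounds (c = 0) and Taylor bounds (c a derivative). *)
Lemma mean_value_line g z e (v c B : R) :
  (forall w, derivable g w e) ->
  (forall tau, `|tau| <= `|v| -> `|'D_e g (z + tau *: e) - c| <= B) ->
  `|g (z + v *: e) - g z - c * v| <= B * `|v|.
Proof.
move=> dg gB; pose phi t := g (z + t *: e).
have dphi (t : R) : is_derive t 1 phi ('D_e g (z + t *: e)) by exact: is_derive_line.
have cphi A : {within A, continuous phi}.
  apply: continuous_subspaceT => t.
  by apply: differentiable_continuous; apply/derivable1_diffP; exact: ex_derive.
have -> : g z = phi 0 by rewrite /phi scale0r addr0.
rewrite -/(phi v).
have [v0|v0] := leP 0 v.
  have [t + ->] := MVT_segment v0 (fun t _ => dphi t) (cphi _).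
  rewrite in_itv/= subr0 => /andP[t0 tv].
  rewrite -mulrBl normrM ler_wpM2r//; apply: gB.
  by rewrite !ger0_norm// (le_trans t0).
have [t + E] := MVT_segment (ltW v0) (fun t _ => dphi t) (cphi _).
rewrite in_itv/= => /andP[tv t0].
have -> : phi v - phi 0 = 'D_e g (z + t *: e) * v.
  by apply: oppr_inj; rewrite opprB E sub0r mulrN.
rewrite -mulrBl normrM ler_wpM2r//; apply: gB.
by rewrite !ler0_norm ?lerN2// ltW.
Qed.

(** Moving one coordinate at a time from x to y reduces the estimate to the
    one-dimensional mean value theorem along coordinate lines, where the
    derivatives are partial derivatives. *)
Lemma mean_value_coordinates g x y (c : 'I_m -> R) (B : R) :
  (forall j w, derivable g w (basis_vec j)) ->
  (forall j w, `|w - x| <= `|y - x| -> `|'D_(basis_vec j) g w - c j| <= B) ->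
  `|g y - g x - \sum_(j < m) c j * (y - x) 0 j| <= m%:R * B * `|y - x|.
Proof.
move=> dg gB.
(* The first k coordinates are those of y. *)
pose z k : 'rV[R]_m := \row_j (if (j < k)%N then y 0 j else x 0 j).
have zS (k : 'I_m) : z k.+1 = z k + (y - x) 0 k *: basis_vec k.
  apply/rowP => j; rewrite !mxE eqxx /= ltnS.
  have [->|jk] := eqVneq j k.
    by rewrite leqnn ltnn mulr1 addrC subrK.
  by rewrite mulr0 addr0 leq_eqVlt (inj_eq val_inj) (negPf jk).
have z0 : z 0 = x by apply/rowP => j; rewrite !mxE ltn0.
have zm : z m = y by apply/rowP => j; rewrite !mxE ltn_ord.
have -> : g y - g x = \sum_(k < m) (g (z k.+1) - g (z k)).
  rewrite -(big_mkord xpredT (fun k => g (z k.+1) - g (z k))).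
  by rewrite telescope_sumr// zm z0.
rewrite -sumrB; apply: le_trans (ler_norm_sum _ _ _) _.
have -> : m%:R * B * `|y - x| = \sum_(k < m) B * `|y - x|.
  by rewrite sumr_const card_ord -[RHS]mulr_natl mulrA.
apply: ler_sum => k _; rewrite zS.
have zB tau : `|tau| <= `|(y - x) 0 k| -> `|'D_(basis_vec k) g (z k + tau *: basis_vec k) - c k| <= B.
  move=> tauv; apply: gB; apply: mx_norm_le => // i j; rewrite ord1 !mxE eqxx /=.
  have [->|jk] := eqVneq j k.
    rewrite ltnn mulr1 addrAC subrr add0r (le_trans tauv)//.
    exact: coord_le_norm.
  rewrite mulr0 addr0; case: ifP => _; last by rewrite subrr normr0.
  by have := coord_le_norm (y - x) 0 j; rewrite !mxE.
apply: le_trans (mean_value_line (fun w => dg k w) zB) _.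
rewrite ler_wpM2l ?coord_le_norm//.
by apply: le_trans (gB k x _); rewrite ?subrr ?normr0.
Qed.

Lemma derivable_shift g w x e :
  derivable g (x + w) e -> derivable (fun z => g (z + w)) x e.
Proof.
move=> dg; have E : (fun h : R => h^-1 *: (((fun z => g (z + w)) \o shift x) (h *: e)
    - g (x + w))) =
  (fun h : R => h^-1 *: ((g \o shift (x + w)) (h *: e) - g (x + w))).
  by apply/funext => h /=; rewrite addrA.
by rewrite /derivable E.
Qed.

Lemma derive_shift g w x e : 'D_e (fun z => g (z + w)) x = 'D_e g (x + w).
Proof.
have E : (fun h : R => h^-1 *: (((fun z => g (z + w)) \o shift x) (h *: e)
    - g (x + w))) =
  (fun h : R => h^-1 *: ((g \o shift (x + w)) (h *: e) - g (x + w))).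
  by apply/funext => h /=; rewrite addrA.
by rewrite /derive E.
Qed.

(** The mean value estimate for the translation difference of g, which turns
    bounds on second differences of the partial derivatives into bounds for
    g itself. *)
Lemma mean_value_difference g x y w (c : 'I_m -> R) (B : R) :
  (forall j w, derivable g w (basis_vec j)) ->
  (forall j z, `|z - x| <= `|y - x| ->
    `|'D_(basis_vec j) g (z + w) - 'D_(basis_vec j) g z - c j| <= B) ->
  `|g (y + w) - g y - (g (x + w) - g x) - \sum_(j < m) c j * (y - x) 0 j|
    <= m%:R * B * `|y - x|.
Proof.
move=> dg gB.
have dgs j z : derivable (fun z => g (z + w)) z (basis_vec j).
  exact: derivable_shift.
apply: (@mean_value_coordinates (fun z => g (z + w) - g z)) => j z.
  exact: derivableB.
by move=> zx; rewrite deriveB// derive_shift; exact: gB.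
Qed.

End mean_value.

Section time.
Context {R : realType} {m : nat}.
Implicit Types (f : R -> 'rV[R]_m -> R).

(** For gamma constant this is continuity in time alone, for gamma a solution it
    is what makes the drift integrable. *)
Lemma within_slab_continuous (T a b : R) f (gamma : R -> 'rV[R]_m) :
  0 <= a -> b <= T ->
  {within slab T, continuous (fun p : R * 'rV[R]_m => f p.1 p.2)} ->
  {within `[a, b], continuous gamma} ->
  {within `[a, b], continuous (fun u => f u (gamma u))}.
Proof.
move=> a0 bT /subspace_continuousP cf /subspace_continuousP cg.
apply/subspace_continuousP => u uab.
have uT : slab T (u, gamma u).
  move: uab; rewrite /slab /= in_itv/= => /andP[au ub].
  by rewrite (le_trans a0 au) (le_trans ub bT).
apply: (@cvg_comp _ _ _ (fun v => (v, gamma v))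
  (fun p : R * 'rV[R]_m => f p.1 p.2) _ _ _ _ (cf _ uT)).
move=> P /= [[P1 P2]] [/= nP1 nP2] HP.
have := cg u uab P2 nP2; rewrite /= !nbhs_simpl /within /= => cgP.
near=> v => vab.
apply: HP => /=.
  split; first by near: v.
  by have := vab; near: v.
move: vab; rewrite /slab /= in_itv/= => /andP[av vb].
by rewrite (le_trans a0 av) (le_trans vb bT).
Unshelve. all: by end_near. Qed.

(** At interior times the restriction of the difference quotient to [0, T] does
    not affect the limit. *)
Lemma time_derivable_is_derive (T : R) f (t : R) x :
  0 < t < T -> time_derivable T f t x ->
  is_derive t 1 (fun s => f s x) (dtime T f t x).
Proof.
move=> /andP[t0 tT] ct.
have shift_cvg : (fun h : R => h + t) @ 0^' --> within [set s | 0 <= s <= T] t^'.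
  move=> P nP.
  have {}nP : \forall s \near t, s != t -> 0 <= s <= T -> P s by exact: nP.
  suff : \forall h \near (0 : R), h != 0 -> P (h + t) by [].
  have nT : \forall s \near t, s \in `]0, T[.
    by apply: near_in_itvoo; rewrite in_itv/= t0.
  have : \forall s \near t, s != t -> P s.
    near=> s => st; apply: (near nP s _ st) => //.
    have : s \in `]0, T[ by near: s.
    by rewrite in_itv/= => /andP[/ltW -> /ltW ->].
  rewrite (near_shift 0 t); apply: filterS => h /=.
  by rewrite subr0 -subr_eq0 addrK.
have ct' : (fun h : R => h^-1 *: (((fun s => f s x) \o shift t) (h *: (1 : R)) - f t x))
     @ 0^' --> dtime T f t x.
  have -> : (fun h : R => h^-1 *: (((fun s => f s x) \o shift t) (h *: (1 : R)) - f t x))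
      = time_quotient f t x \o (fun h => h + t).
    apply/funext => h; rewrite /time_quotient /= addrK /GRing.scale /= mulr1.
    by rewrite mulrC.
  apply: (cvg_comp _ _ shift_cvg ct).
apply: DeriveDef; first by apply/cvg_ex; exists (dtime T f t x).
exact: cvg_lim ct'.
Unshelve. all: by end_near. Qed.

End time.

(** * Bounded Lipschitz functions and Taylor estimates *)

Section regularity.
Context {R : realType} {m : nat} (T : R).
Implicit Types (f g : R -> 'rV[R]_m -> R).

(** A single constant bounds f and its joint Lipschitz behaviour: this class is
    stable under products, hence contains D sigma . sigma. *)
Definition bdd_lip f := exists2 C : R, 0 <= C & forall (s t : R) x y,
  0 <= s <= T -> 0 <= t <= T ->
  `|f t x| <= C /\ `|f t x - f s y| <= C * (`|t - s| + `|x - y|).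

(** The consequence of membership in C_b^(1,2) that the existence proof uses:
    derivatives in time enter only through Lipschitz bounds. *)
Definition lip_diff f := [/\ bdd_lip f,
  forall j (t : R) x, 0 <= t <= T -> derivable (f t) x (basis_vec j) &
  forall j, bdd_lip (dspace f j)].

Lemma bdd_lip_cst (c : R) : bdd_lip (fun _ _ => c).
Proof.
exists `|c| => // s t x y _ _; split => //.
by rewrite subrr normr0 mulr_ge0// addr_ge0.
Qed.

Lemma bdd_lipD f g : bdd_lip f -> bdd_lip g ->
  bdd_lip (fun t x => f t x + g t x).
Proof.
move=> [C C0 Hf] [D D0 Hg]; exists (C + D); first exact: addr_ge0.
move=> s t x y sT tT; have [f1 f2] := Hf s t x y sT tT.
have [g1 g2] := Hg s t x y sT tT; split.
  by rewrite (le_trans (ler_normD _ _))// lerD.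
by rewrite opprD addrACA (le_trans (ler_normD _ _))// mulrDl lerD.
Qed.

Lemma bdd_lipM f g : bdd_lip f -> bdd_lip g ->
  bdd_lip (fun t x => f t x * g t x).
Proof.
move=> [C C0 Hf] [D D0 Hg]; exists (C * D + C * D).
  by rewrite addr_ge0// mulr_ge0.
move=> s t x y sT tT; have [f1 f2] := Hf s t x y sT tT.
have [g1 g2] := Hg s t x y sT tT; have [f3 _] := Hf s s y y sT sT.
split.
  by rewrite normrM (le_trans (ler_pM _ _ f1 g1))// lerDl mulr_ge0.
have -> : f t x * g t x - f s y * g s y =
  (f t x - f s y) * g t x + f s y * (g t x - g s y) by ring.
rewrite (le_trans (ler_normD _ _))// [leRHS]mulrDl !normrM lerD//.
  by rewrite mulrAC ler_pM.
by rewrite -mulrA ler_pM.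
Qed.

Lemma bdd_lip_sum n (F : 'I_n -> R -> 'rV[R]_m -> R) :
  (forall i, bdd_lip (F i)) -> bdd_lip (fun t x => \sum_(i < n) F i t x).
Proof.
elim: n F => [|n IH] F HF.
  have -> : (fun t x => \sum_(i < 0) F i t x) = (fun _ _ => 0).
    by apply/funext => t; apply/funext => x; rewrite big_ord0.
  exact: bdd_lip_cst.
have -> : (fun t x => \sum_(i < n.+1) F i t x) =
    (fun t x => \sum_(i < n) F (widen_ord (leqnSn n) i) t x + F ord_max t x).
  by apply/funext => t; apply/funext => x; rewrite big_ord_recr.
by apply: bdd_lipD => //; apply: IH.
Qed.

Lemma Cb_bounded k l f : Cb T k l f ->
  exists C, forall (t : R) x, 0 <= t <= T -> `|f t x| <= C.
Proof. by case: l => [|l] [] + _; case: k => [|k] [[_ ?] _]. Qed.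

Lemma Cb_time_lip l f : Cb T 1 l f -> exists2 C, 0 <= C &
  forall (s t : R) x, 0 <= s <= T -> 0 <= t <= T ->
    `|f t x - f s x| <= C * `|t - s|.
Proof.
move=> fC; have [[cf _] [df [[_ [C HC]] _]]] : Cb_time T 1 f.
  by case: l fC => [|l] [].
suff H s t x : 0 <= s -> t <= T -> s <= t -> `|f t x - f s x| <= `|C| * `|t - s|.
  exists `|C| => // s t x /andP[s0 sT] /andP[t0 tT].
  have [st|/ltW ts] := leP s t; first exact: H.
  by rewrite distrC [X in _ * X]distrC; exact: H.
move=> s0 tT st; have dft u : u \in `]s, t[ ->
    is_derive u 1 (fun v => f v x) (dtime T f u x).
  rewrite in_itv/= => /andP[su ut].
  apply: time_derivable_is_derive; first by rewrite (le_lt_trans s0)// (lt_le_trans ut).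
  by apply: df; rewrite (le_trans s0 (ltW su)) (le_trans (ltW ut) tT).
have cft : {within `[s, t], continuous (fun v => f v x)}.
  apply: (@within_slab_continuous _ _ T s t f (fun=> x)) => //.
  exact/continuous_subspaceT/cst_continuous.
have [u + ->] := MVT_segment st dft cft.
rewrite in_itv/= => /andP[su ut]; rewrite normrM ler_wpM2r//.
rewrite (le_trans _ (ler_norm _))//; apply: HC.
by rewrite (le_trans s0 su) (le_trans ut tT).
Qed.

Lemma Cb_space_lip k l f : Cb T k l.+1 f -> exists2 C, 0 <= C &
  forall (t : R) x y, 0 <= t <= T -> `|f t x - f t y| <= C * `|x - y|.
Proof.
move=> [_ fC].
have [||D D0 HD] := @common_bound R m
    (fun j C => forall (t : R) x, 0 <= t <= T -> `|dspace f j t x| <= C).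
- by move=> j c c' cc' H t x tT; exact: le_trans (H t x tT) cc'.
- by move=> j; have [_ /Cb_bounded] := fC j.
exists (m%:R * D); first exact: mulr_ge0.
move=> t x y tT.
have := @mean_value_coordinates R m (f t) y x (fun=> 0) D.
rewrite big1 ?subr0; last by move=> j _; rewrite mul0r.
apply=> [j w|j w _]; first by have [+ _] := fC j; exact.
by rewrite subr0; exact: HD.
Qed.

Lemma Cb_bdd_lip l f : Cb T 1 l.+1 f -> bdd_lip f.
Proof.
move=> fC; have [B HB] := Cb_bounded fC.
have [C C0 HC] := Cb_time_lip fC; have [D D0 HD] := Cb_space_lip fC.
exists (`|B| + C + D); first by rewrite !addr_ge0.
move=> s t x y sT tT; split.
  rewrite (le_trans (HB t x tT))// (le_trans (ler_norm _))// -addrA lerDl.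
  exact: addr_ge0.
rewrite -(subrKA (f s x)) (le_trans (ler_normD _ _))// mulrDr lerD//.
  by rewrite (le_trans (HC s t x sT tT))// ler_wpM2r// addrAC lerDr addr_ge0.
by rewrite (le_trans (HD s x y sT))// ler_wpM2r// lerDr addr_ge0.
Qed.

Lemma Cb_lip_diff l f : Cb T 1 l.+2 f -> lip_diff f.
Proof.
move=> fC; split; first exact: Cb_bdd_lip fC.
  by move=> j t x tT; have [+ _] := fC.2 j; exact.
by move=> j; have [_] := fC.2 j; exact: Cb_bdd_lip.
Qed.

Lemma lip_diff_common f : lip_diff f -> exists2 C : R, 0 <= C &
  forall j (s t : R) x y, 0 <= s <= T -> 0 <= t <= T ->
  `|dspace f j t x - dspace f j s y| <= C * (`|t - s| + `|x - y|).
Proof.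
move=> [_ _ f']; apply: common_bound => [j c c' cc' H s t x y sT tT|j].
  by rewrite (le_trans (H s t x y sT tT))// ler_wpM2r// addr_ge0.
by have [C _ HC] := f' j; exists C => s t x y sT tT; have [] := HC s t x y sT tT.
Qed.

Lemma lip_diff_taylor f : lip_diff f -> exists2 C : R, 0 <= C &
  forall (t : R) x y, 0 <= t <= T ->
  `|f t y - f t x - \sum_(j < m) dspace f j t x * (y - x) 0 j| <= C * `|y - x| ^+ 2.
Proof.
move=> fC; have [C C0 HC] := lip_diff_common fC; have [_ df _] := fC.
exists (m%:R * C); first exact: mulr_ge0.
move=> t x y tT; rewrite expr2 mulrA -(mulrA _ C).
apply: mean_value_coordinates => [j w|j w wx]; first exact: df.
rewrite (le_trans (HC j t t w x tT tT))// ler_wpM2l// subrr normr0 add0r.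
exact: wx.
Qed.

(** The function f (. + w) - f has partial derivatives of size |w|. *)
Lemma lip_diff_parallelogram f : lip_diff f -> exists2 C : R, 0 <= C &
  forall (t : R) x y w, 0 <= t <= T ->
  `|f t (y + w) - f t y - (f t (x + w) - f t x)| <= C * (`|w| * `|y - x|).
Proof.
move=> fC; have [C C0 HC] := lip_diff_common fC; have [_ df _] := fC.
exists (m%:R * C); first exact: mulr_ge0.
move=> t x y w tT; rewrite mulrA -(mulrA _ C).
have := @mean_value_difference R m (f t) x y w (fun=> 0) (C * `|w|).
rewrite big1 ?subr0; last by move=> j _; rewrite mul0r.
apply=> [j z|j z zx]; first exact: df.
rewrite subr0 (le_trans (HC j t t (z + w) z tT tT))//.
by rewrite subrr normr0 add0r addrAC subrr add0r.
Qed.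

(** Moving a and c from time t to time s costs a multiple of |t - s| |a - c|;
    then c is replaced by d + (a - b), which completes a parallelogram with
    a, b and d. *)
Lemma lip_diff_four_points f : lip_diff f -> exists2 C : R, 0 <= C &
  forall (s t : R) a b c d, 0 <= s <= T -> 0 <= t <= T ->
  `|f t a - f s b - (f t c - f s d)| <=
    C * (`|t - s| * `|a - c| + `|a - b| * `|b - d| + `|a - b - (c - d)|).
Proof.
move=> fC; have [C C0 HC] := lip_diff_common fC; have [[D D0 HD] df _] := fC.
have [E E0 HE] := lip_diff_parallelogram fC.
exists (m%:R * C + E + D); first by rewrite !addr_ge0// mulr_ge0.
move=> s t a b c d sT tT.
have H1 : `|f t a - f s a - (f t c - f s c)| <= m%:R * C * (`|t - s| * `|a - c|).
  rewrite mulrA -(mulrA _ C).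
  have := @mean_value_coordinates R m (fun z => f t z - f s z) c a (fun=> 0) (C * `|t - s|).
  rewrite big1 ?subr0; last by move=> j _; rewrite mul0r.
  apply=> [j z|j z zx]; first by apply: derivableB; exact: df.
  rewrite deriveB; [|exact: df|exact: df].
  rewrite subr0 (le_trans (HC j s t z z sT tT))//.
  by rewrite subrr normr0 addr0.
have H2 := HE s d b (a - b) sT.
have [_ H3] := HD s s (d + (a - b)) c sT sT.
rewrite subrr normr0 add0r in H3.
have -> : f t a - f s b - (f t c - f s d) =
  (f t a - f s a - (f t c - f s c)) +
  (f s (b + (a - b)) - f s b - (f s (d + (a - b)) - f s d)) +
  (f s (d + (a - b)) - f s c).
  by rewrite (addrC b) subrK; ring.
have -> : a - b - (c - d) = d + (a - b) - c by rewrite opprB addrC addrAC.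
have le1 (u v w : R) : 0 <= v -> 0 <= w -> u <= u + v + w.
  by move=> ? ?; rewrite -addrA lerDl addr_ge0.
have n1 : 0 <= m%:R * C by rewrite mulr_ge0.
rewrite (le_trans (ler_normD _ _))// !mulrDr lerD//; last first.
  apply: le_trans H3 _.
  by rewrite ler_wpM2r// lerDr addr_ge0.
rewrite (le_trans (ler_normD _ _))// lerD//.
  by apply: le_trans H1 _; rewrite ler_wpM2r ?mulr_ge0// -addrA lerDl addr_ge0.
by apply: le_trans H2 _; rewrite ler_wpM2r ?mulr_ge0// addrAC lerDr addr_ge0.
Qed.

(** Stability of the first-order Taylor remainder in both the base point and the
    increment. With equal increments this is the mean value estimate for the
    difference of two translates of f; changing the increment is a
    first-order Taylor estimate around d. *)
Lemma lip_diff_taylor_difference f :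
  lip_diff f -> (forall j, lip_diff (dspace f j)) ->
  exists2 C : R, 0 <= C & forall (t : R) a b c d, 0 <= t <= T ->
  `|(f t a - f t b - \sum_(j < m) dspace f j t b * (a - b) 0 j) -
    (f t c - f t d - \sum_(j < m) dspace f j t d * (c - d) 0 j)| <=
    C * (`|a - b| ^+ 2 * `|b - d| +
         (`|a - b| + `|c - d|) * `|a - b - (c - d)|).
Proof.
move=> fC f'C; have [C C0 HC] := lip_diff_common fC; have [_ df _] := fC.
have [||E E0 HE] := @common_bound R m (fun j E => forall (t : R) x y w, 0 <= t <= T ->
  `|dspace f j t (y + w) - dspace f j t y - (dspace f j t (x + w) - dspace f j t x)|
   <= E * (`|w| * `|y - x|)).
- by move=> j c c' cc' H t x y w tT; rewrite (le_trans (H t x y w tT))// ler_wpM2r// mulr_ge0.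
- by move=> j; have [c _ Hc] := lip_diff_parallelogram (f'C j); exists c.
exists (m%:R * E + m%:R * (2 * C)); first by rewrite !addr_ge0// !mulr_ge0.
move=> t a b c d tT.
pose v := a - b; pose w := b - d.
have H1 : `|f t (d + v + w) - f t (d + v) - (f t (d + w) - f t d) -
    \sum_(j < m) (dspace f j t (d + w) - dspace f j t d) * (d + v - d) 0 j| <=
    m%:R * (E * (`|w| * `|v|)) * `|d + v - d|.
  apply: mean_value_difference => [j z|j z zd]; first exact: df.
  rewrite (le_trans (HE j t d z w tT))// ler_wpM2l// ler_wpM2l//.
  by rewrite (le_trans zd)// addrAC subrr add0r.
have vc : d + v - c = v - (c - d) by apply/rowP => i; rewrite !mxE; ring.
have dv : d + v - d = v by rewrite addrAC subrr add0r.
have H2 : `|f t (d + v) - f t c - \sum_(j < m) dspace f j t d * (d + v - c) 0 j|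
    <= m%:R * (C * (2 * (`|v| + `|c - d|))) * `|d + v - c|.
  apply: mean_value_coordinates => [j z|j z zd]; first exact: df.
  rewrite (le_trans (HC j t t z d tT tT))// ler_wpM2l//.
  rewrite subrr normr0 add0r -(subrKA c) (le_trans (ler_normD _ _))//.
  have : `|d + v - c| <= `|v| + `|c - d|.
    by rewrite vc ler_normB.
  move: zd (normr_ge0 v) (normr_ge0 (c - d)).
  move: `|z - c| `|d + v - c| `|v| `|c - d| => p q r s; clear; lra.
have dw : d + w = b by rewrite addrC subrK.
have dvw : d + v + w = a by rewrite addrAC dw addrC subrK.
rewrite dv dw dvw in H1; rewrite vc in H2.
set S1 := (X in `|_ - X| <= _) in H1; set S2 := (X in `|_ - X| <= _) in H2.
have -> : (f t a - f t b - \sum_(j < m) dspace f j t b * (a - b) 0 j) -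
    (f t c - f t d - \sum_(j < m) dspace f j t d * (c - d) 0 j) =
    (f t a - f t (d + v) - (f t b - f t d) - S1) + (f t (d + v) - f t c - S2).
  have -> : \sum_(j < m) dspace f j t b * (a - b) 0 j = S1 +
      \sum_(j < m) dspace f j t d * (c - d) 0 j + S2.
    rewrite /S1 /S2 -!big_split /=; apply: eq_bigr => j _; rewrite !mxE.
    by ring.
  by ring.
rewrite (le_trans (ler_normD _ _))// -/v -/w.
rewrite mulrDl; apply: lerD.
  rewrite (le_trans H1)//.
  have -> : m%:R * (E * (`|w| * `|v|)) * `|v| = m%:R * E * (`|v| ^+ 2 * `|w|) by ring.
  by rewrite ler_wpM2l ?mulr_ge0// lerDl mulr_ge0// addr_ge0.
rewrite (le_trans H2)//.
have -> : m%:R * (C * (2 * (`|v| + `|c - d|))) * `|v - (c - d)| =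
  m%:R * (2 * C) * ((`|v| + `|c - d|) * `|v - (c - d)|) by ring.
by rewrite ler_wpM2l ?mulr_ge0// lerDr mulr_ge0// exprn_ge0.
Qed.

End regularity.

(** * Integrals of continuous functions *)

Section integral.
Context {R : realType}.
Notation mu := (@lebesgue_measure R).
Implicit Types (f g : R -> R).

Lemma within_continuous_integrable (T s t : R) f : 0 <= s -> t <= T ->
  {within `[0, T], continuous f} -> mu.-integrable `[s, t] (EFin \o f).
Proof.
move=> s0 tT cf; apply: continuous_compact_integrable.
  exact: segment_compact.
apply: continuous_subspaceW cf => u /=.
by rewrite !in_itv/= => /andP[su ut]; rewrite (le_trans s0 su) (le_trans ut tT).
Qed.

Lemma Rintegral_chasles (T s u t : R) f :
  0 <= s -> s <= u -> u <= t -> t <= T -> {within `[0, T], continuous f} ->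
  \int[mu]_(v in `[s, t]) f v =
    \int[mu]_(v in `[s, u]) f v + \int[mu]_(v in `[u, t]) f v.
Proof.
move=> s0 su ut tT cf.
have ist := within_continuous_integrable s0 tT cf.
have := Rintegral_itvB ist (_ : (BLeft s <= BRight u)%O) (_ : (BRight u <= BRight t)%O).
rewrite !bnd_simp => /(_ su ut) E.
rewrite -(@Rintegral_itv_obnd_cbnd _ u (BRight t)) -?E; first by rewrite addrC subrK.
apply: integrableS ist => // v /=; rewrite !in_itv/= => /andP[uv ->].
by rewrite (le_trans su (ltW uv)).
Qed.

(** With g = 0 this is the bound of the integral by the supremum. *)
Lemma Rintegral_dist (T s t M : R) f g :
  0 <= s -> s <= t -> t <= T ->
  {within `[0, T], continuous f} -> {within `[0, T], continuous g} ->
  (forall v, s <= v <= t -> `|f v - g v| <= M) ->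
  `|\int[mu]_(v in `[s, t]) f v - \int[mu]_(v in `[s, t]) g v| <= M * (t - s).
Proof.
move=> s0 st tT cf cg fg.
have fi := within_continuous_integrable s0 tT cf.
have gi := within_continuous_integrable s0 tT cg.
have mst : measurable (`[s, t] : set R) by exact: measurable_itv.
rewrite -RintegralB//.
have fgi : mu.-integrable `[s, t] (EFin \o (fun v => f v - g v)).
  by rewrite (_ : EFin \o _ = (EFin \o f) \- (EFin \o g))%E //; exact: integrableB.
rewrite (le_trans (le_normr_Rintegral _ fgi))//.
have -> : M * (t - s) = \int[mu]_(v in `[s, t]) M.
  rewrite Rintegral_cst//=; congr (_ * _).
  rewrite lebesgue_measure_itv/= lte_fin.
  by move: st; rewrite le_eqVlt => /predU1P[->|->//]; rewrite ltxx subrr.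
apply: le_Rintegral => //.
- exact: integrable_norm fgi.
- by apply: within_continuous_integrable s0 tT _; exact/continuous_subspaceT/cst_continuous.
Qed.

Lemma Rintegral_bound (T s t M : R) f :
  0 <= s -> s <= t -> t <= T ->
  {within `[0, T], continuous f} ->
  (forall v, s <= v <= t -> `|f v| <= M) ->
  `|\int[mu]_(v in `[s, t]) f v| <= M * (t - s).
Proof.
move=> s0 st tT cf fM.
have c0 : {within `[0, T], continuous (fun _ : R => 0 : R)}.
  exact/continuous_subspaceT/cst_continuous.
have := @Rintegral_dist T s t M f (fun=> 0) s0 st tT cf c0.
rewrite (@Rintegral_cst _ _ _ mu)// mul0r subr0; apply => v vst.
by rewrite subr0; exact: fM.
Qed.

End integral.

(** * First-order expansions along controlled increments *)

Section generalized_elements.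
Context {R : realType} {m : nat} (T : R) {X : Type}.
Implicit Types (f : R -> 'rV[R]_m -> R) (s t u : X -> R) (xi eta : X -> 'rV[R]_m).

Definition times s := forall x, 0 <= s x <= T.

Lemma lesssim_bounded f s xi : bdd_lip T f -> times s ->
  (fun x => f (s x) (xi x)) <~ (fun=> 1).
Proof.
move=> [C C0 HC] sT; exists C => // x; rewrite mulr1.
by have [] := HC (s x) (s x) (xi x) (xi x) (sT x) (sT x).
Qed.

Lemma lesssim_lip f s u xi eta a : bdd_lip T f -> times s -> times u ->
  (fun x => u x - s x) <~ a -> (fun x => `|eta x - xi x|) <~ a ->
  (fun x => f (u x) (eta x) - f (s x) (xi x)) <~ a.
Proof.
move=> [C C0 HC] sT uT us ex.
apply: lesssim_trans (lesssimD (lesssim_norm us) ex).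
exists C => // x.
by have [] := HC (s x) (u x) (eta x) (xi x) (sT x) (uT x).
Qed.

Lemma lesssim_lip_space f s xi eta a : bdd_lip T f -> times s ->
  (forall x, 0 <= a x) -> (fun x => `|eta x - xi x|) <~ a ->
  (fun x => f (s x) (eta x) - f (s x) (xi x)) <~ a.
Proof.
move=> fC sT a0 ex; apply: lesssim_lip => //.
by exists 0 => // x; rewrite subrr normr0 mul0r.
Qed.

End generalized_elements.

Section controlled_calculus.
Context {R : realType} {m d : nat} (T : R).
Context (sig : 'I_m -> 'I_d -> R -> 'rV[R]_m -> R).
Hypothesis sigC : forall i k, lip_diff T (sig i k).

(** The derivative of f along the l-th column of sigma: for f = sigma_ik this is
    the coefficient of zeta2^(l k) in the expansion of a solution, and the
    derivative of f(s, x_s) as a path controlled by zeta. *)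
Definition derivative_along f l (t : R) (x : 'rV[R]_m) : R :=
  \sum_(j < m) dspace f j t x * sig j l t x.

Lemma bdd_lip_derivative_along f l : lip_diff T f ->
  bdd_lip T (derivative_along f l).
Proof.
move=> [_ _ f']; apply: bdd_lip_sum => j; apply: bdd_lipM => //.
by have [] := sigC j l.
Qed.

Section expansion.
Context {X : Type} (s u : X -> R) (xi eta : X -> 'rV[R]_m) (z : X -> 'I_d -> R).
Context (p : X -> R).
Hypotheses (sT : times T s) (uT : times T u) (p0 : forall x, 0 <= p x).
Hypotheses (p1 : p <~ (fun=> 1)) (us : (fun x => u x - s x) <~ (fun x => p x ^+ 2)).
Hypothesis zp : forall l, (fun x => z x l) <~ p.

(** What remains of the increment eta - xi after its expected first-order part
    sigma(s, xi) z, where z stands for the increment of zeta from s to u. *)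
Definition first_order_remainder x : 'rV[R]_m :=
  \row_j ((eta x - xi x) 0 j - \sum_(l < d) sig j l (s x) (xi x) * z x l).

Let r := first_order_remainder.
Hypothesis rp : forall j, (fun x => r x 0 j) <~ (fun x => p x ^+ 2).

Lemma sqr_lesssim : (fun x => p x ^+ 2) <~ p.
Proof.
apply: lesssim_extr (lesssimM p1 (lesssim_refl p0)) => x.
by rewrite mul1r.
Qed.

Lemma increment_lesssim : (fun x => `|eta x - xi x|) <~ p.
Proof.
apply: lesssim_mx => // i j; rewrite ord1.
apply: (@lesssim_ext _ _ _ (fun x => r x 0 j +
  \sum_(l < d) sig j l (s x) (xi x) * z x l)).
  by move=> x; rewrite /r !mxE subrK.
apply: lesssimD; first exact: lesssim_trans sqr_lesssim.
apply: lesssim_sum => // l; apply: lesssimMl => //.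
by apply: lesssim_bounded => //; have [] := sigC j l.
Qed.

Lemma taylor_decomposition f x :
  f (u x) (eta x) - f (s x) (xi x) -
    \sum_(l < d) derivative_along f l (s x) (xi x) * z x l =
  (f (u x) (eta x) - f (s x) (eta x)) +
  (f (s x) (eta x) - f (s x) (xi x) -
    \sum_(j < m) dspace f j (s x) (xi x) * (eta x - xi x) 0 j) +
  \sum_(j < m) dspace f j (s x) (xi x) * r x 0 j.
Proof.
have -> : \sum_(j < m) dspace f j (s x) (xi x) * r x 0 j =
  \sum_(j < m) dspace f j (s x) (xi x) * (eta x - xi x) 0 j -
  \sum_(l < d) derivative_along f l (s x) (xi x) * z x l.
  under eq_bigr do rewrite mxE mulrBr mulr_sumr.
  rewrite sumrB exchange_big /=; congr (_ - _).
  apply: eq_bigr => l _; rewrite /derivative_along mulr_suml.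
  by apply: eq_bigr => j _; rewrite mulrA.
by ring.
Qed.

(** A smooth function of a controlled path is controlled: the change of time,
    the Taylor remainder in space and the effect of the remainder of the
    increment are all of second order in p. *)
Lemma expansion_lesssim f : lip_diff T f ->
  (fun x => f (u x) (eta x) - f (s x) (xi x) -
    \sum_(l < d) derivative_along f l (s x) (xi x) * z x l)
  <~ (fun x => p x ^+ 2).
Proof.
move=> fC; have [f0 _ f'] := fC.
have p20 x : 0 <= p x ^+ 2 by exact: exprn_ge0.
apply: lesssim_ext (taylor_decomposition f) _.
apply: lesssimD; first apply: lesssimD.
- apply: (lesssim_lip f0) => //.
  by exists 0 => // x; rewrite /= subrr !normr0 mul0r.
- have [C C0 HC] := lip_diff_taylor fC.
  apply: (@lesssim_trans _ _ (fun x => `|eta x - xi x| ^+ 2)).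
    by exists C => // x; exact: HC.
  exact: lesssimM increment_lesssim increment_lesssim.
- apply: lesssim_sum => // j; apply: lesssimMl => //.
  by apply: lesssim_bounded.
Qed.

End expansion.

Section expansion_difference.
Context {X : Type} (s u : X -> R) (xi eta xi' eta' : X -> 'rV[R]_m).
Context (z : X -> 'I_d -> R) (p E : X -> R).
Hypotheses (sT : times T s) (uT : times T u) (p0 : forall x, 0 <= p x).
Hypotheses (p1 : p <~ (fun=> 1)) (us : (fun x => u x - s x) <~ (fun x => p x ^+ 2)).
Hypothesis zp : forall l, (fun x => z x l) <~ p.
Let r := first_order_remainder s xi eta z.
Let r' := first_order_remainder s xi' eta' z.
Hypothesis rp : forall j, (fun x => r x 0 j) <~ (fun x => p x ^+ 2).
Hypothesis rp' : forall j, (fun x => r' x 0 j) <~ (fun x => p x ^+ 2).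
Hypothesis E0 : forall x, 0 <= E x.
Hypothesis xiE : (fun x => `|xi x - xi' x|) <~ E.
Hypothesis etaE : (fun x => `|eta x - eta' x|) <~ E.
Hypothesis rE : forall j, (fun x => r x 0 j - r' x 0 j) <~ (fun x => E x * p x ^+ 2).

Let Ep0 x : 0 <= E x * p x. Proof. exact: mulr_ge0. Qed.
Let Ep20 x : 0 <= E x * p x ^+ 2. Proof. by rewrite mulr_ge0// exprn_ge0. Qed.
Let ep := increment_lesssim sT p0 p1 zp rp.
Let ep' := increment_lesssim sT p0 p1 zp rp'.
Let p2p := sqr_lesssim p0 p1.

Let Ep2p : (fun x => E x * p x ^+ 2) <~ (fun x => E x * p x).
Proof. exact: lesssimM (lesssim_refl E0) p2p. Qed.

Lemma increment_difference_lesssim :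
  (fun x => `|eta x - xi x - (eta' x - xi' x)|) <~ (fun x => E x * p x).
Proof.
apply: lesssim_mx => // i j; rewrite ord1.
apply: (@lesssim_ext _ _ _ (fun x => (r x 0 j - r' x 0 j) +
  \sum_(l < d) (sig j l (s x) (xi x) - sig j l (s x) (xi' x)) * z x l)).
  move=> x; under eq_bigr do rewrite mulrBl.
  by rewrite sumrB /r /r' !mxE; ring.
apply: lesssimD; first exact: lesssim_trans Ep2p.
apply: lesssim_sum => // l; apply: lesssimM => //.
by apply: lesssim_lip_space => //; have [] := sigC j l.
Qed.

(** Each term of [lip_diff_four_points] is of size E p: the points of the two
    pairs are at distance E, their increments are of size p and differ by E
    p. *)
Lemma four_points_lesssim f : lip_diff T f ->
  (fun x => f (u x) (eta x) - f (s x) (xi x)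
    - (f (u x) (eta' x) - f (s x) (xi' x))) <~ (fun x => E x * p x).
Proof.
move=> fC; have [C C0 HC] := lip_diff_four_points fC.
apply: (@lesssim_trans _ _ (fun x => `|u x - s x| * `|eta x - eta' x| +
  `|eta x - xi x| * `|xi x - xi' x| +
  `|eta x - xi x - (eta' x - xi' x)|)).
  by exists C => // x; exact: HC.
apply: lesssimD; last exact: increment_difference_lesssim.
apply: lesssimD.
- apply: lesssim_trans Ep2p.
  by apply: lesssim_extr (lesssimM (lesssim_norm us) etaE) => x; rewrite mulrC.
- by apply: lesssim_extr (lesssimM ep xiE) => x; rewrite mulrC.
Qed.

(** The difference of two increments of a product splits into four terms: two
    differences of increments of one factor, of size E p, against values of
    the other, and two products of a difference of size E by an increment of
    size p. *)
Lemma derivative_along_difference f l :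
  lip_diff T f -> (forall j, lip_diff T (dspace f j)) ->
  (fun x => derivative_along f l (u x) (eta x) - derivative_along f l (s x) (xi x)
    - (derivative_along f l (u x) (eta' x) - derivative_along f l (s x) (xi' x)))
  <~ (fun x => E x * p x).
Proof.
move=> fC f'C; have [_ _ f'] := fC.
pose F j : X -> R := fun x => let D := dspace f j in let S := sig j l in
  (D (u x) (eta x) - D (s x) (xi x) - (D (u x) (eta' x) - D (s x) (xi' x)))
      * S (u x) (eta x) +
  (S (u x) (eta x) - S (u x) (eta' x)) * (D (u x) (eta' x) - D (s x) (xi' x)) +
  D (s x) (xi x) *
  (S (u x) (eta x) - S (s x) (xi x) - (S (u x) (eta' x) - S (s x) (xi' x))) +
  (D (s x) (xi x) - D (s x) (xi' x)) * (S (u x) (eta' x) - S (s x) (xi' x)).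
apply: (@lesssim_ext _ _ _ (fun x => \sum_(j < m) F j x)).
  move=> x; rewrite /derivative_along -!sumrB.
  by apply: eq_bigr => j _; rewrite /F /=; ring.
apply: lesssim_sum => // j.
have [S0 _ _] := sigC j l; have D0 := f' j.
have us' : (fun x => u x - s x) <~ p by exact: lesssim_trans p2p.
apply: lesssimD; first apply: lesssimD; first apply: lesssimD.
- apply: lesssimMr; first exact: four_points_lesssim.
  exact: (lesssim_bounded eta S0 uT).
- apply: lesssimM; first exact: (lesssim_lip_space S0 uT E0 etaE).
  exact: (lesssim_lip D0 sT uT us' ep').
- apply: lesssimMl; first exact: (lesssim_bounded xi D0 sT).
  exact: four_points_lesssim.
- apply: lesssimM; first exact: (lesssim_lip_space D0 sT E0 xiE).
  exact: (lesssim_lip S0 sT uT us' ep').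
Qed.

(** The three terms of the decomposition are Lipschitz in the pair of points.
    The Taylor remainder is compared with the help of a further space
    derivative of f. *)
Lemma expansion_difference_lesssim f :
  lip_diff T f -> (forall j, lip_diff T (dspace f j)) ->
  (fun x => (f (u x) (eta x) - f (s x) (xi x) -
      \sum_(l < d) derivative_along f l (s x) (xi x) * z x l) -
    (f (u x) (eta' x) - f (s x) (xi' x) -
      \sum_(l < d) derivative_along f l (s x) (xi' x) * z x l))
  <~ (fun x => E x * p x ^+ 2).
Proof.
move=> fC f'C; have [f0 _ f'] := fC.
pose rem (v w : X -> 'rV[R]_m) x := f (s x) (v x) - f (s x) (w x) -
    \sum_(j < m) dspace f j (s x) (w x) * (v x - w x) 0 j.
apply: (@lesssim_ext _ _ _ (fun x =>
  (f (u x) (eta x) - f (s x) (eta x) - (f (u x) (eta' x) - f (s x) (eta' x))) +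
  (rem eta xi x - rem eta' xi' x) +
  \sum_(j < m) (dspace f j (s x) (xi x) * (r x 0 j - r' x 0 j) +
    (dspace f j (s x) (xi x) - dspace f j (s x) (xi' x)) * r' x 0 j))).
  move=> x; rewrite !taylor_decomposition -/r -/r' /rem.
  have -> : \sum_(j < m) (dspace f j (s x) (xi x) * (r x 0 j - r' x 0 j) +
      (dspace f j (s x) (xi x) - dspace f j (s x) (xi' x)) * r' x 0 j) =
    \sum_(j < m) dspace f j (s x) (xi x) * r x 0 j -
    \sum_(j < m) dspace f j (s x) (xi' x) * r' x 0 j.
    by rewrite -sumrB; apply: eq_bigr => j _; ring.
  by ring.
apply: lesssimD; first apply: lesssimD.
- have [C C0 HC] := lip_diff_four_points fC.
  apply: (@lesssim_trans _ _ (fun x => `|u x - s x| * `|eta x - eta' x|)).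
    exists C => // x; rewrite (le_trans (HC (s x) (u x) _ _ _ _ (sT x) (uT x)))//.
    by rewrite !subrr normr0 mul0r !addr0.
  by apply: lesssim_extr (lesssimM (lesssim_norm us) etaE) => x; rewrite mulrC.
- have [C C0 HC] := lip_diff_taylor_difference fC f'C.
  apply: (@lesssim_trans _ _ (fun x => `|eta x - xi x| ^+ 2 * `|xi x - xi' x| +
    (`|eta x - xi x| + `|eta' x - xi' x|) * `|eta x - xi x - (eta' x - xi' x)|)).
    by exists C => // x; exact: HC.
  apply: lesssimD.
    by apply: lesssim_extr (lesssimM (lesssimM ep ep) xiE) => x; rewrite mulrC.
  apply: lesssim_extr (lesssimM (lesssimD ep ep') increment_difference_lesssim) => x.
  by rewrite mulrCA.
- apply: lesssim_sum => // j; apply: lesssimD.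
    by apply: lesssimMl => //; exact: (lesssim_bounded xi (f' j) sT).
  apply: lesssimM => //; exact: (lesssim_lip_space (f' j) sT E0 xiE).
Qed.

End expansion_difference.

End controlled_calculus.

(** * The rough germ and its composition defect *)

Section germ.
Context {R : realType} {m d : nat} (T kappa : R).
Hypotheses (kappa_gt0 : 0 < kappa) (kappa_le : kappa <= 2^-1).

Lemma powR_le_mono (a b : R) : 0 <= a -> a <= b -> a `^ kappa <= b `^ kappa.
Proof.
move=> a0 ab; have b0 := le_trans a0 ab.
by apply: ge0_ler_powR; rewrite ?nnegrE//; exact: ltW.
Qed.

(** This is where kappa <= 1/2 matters: a time step is of second order in (t -
    s)^kappa, so that drifts and time changes count as second-order terms. *)
Lemma le_powR_sqr (h : R) : 0 <= h <= T ->
  h <= T `^ (1 - 2 * kappa) * (h `^ kappa) ^+ 2.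
Proof.
move=> /andP[h0 hT].
rewrite -powR_mulrn ?powR_ge0// -powRrM (mulrC kappa).
have -> : h <= T `^ (1 - 2 * kappa) * h `^ (2 * kappa) =
   (h `^ (1 - 2 * kappa) * h `^ (2 * kappa) <= T `^ (1 - 2 * kappa) * h `^ (2 * kappa)).
  by rewrite -powRD ?subrK ?powRr1// oner_eq0.
rewrite ler_wpM2r ?powR_ge0//; apply: ge0_ler_powR; rewrite ?nnegrE//.
  by move: kappa_le; rewrite -subr_ge0; lra.
exact: le_trans hT.
Qed.

Definition rough_path_bounds (zeta : R -> 'rV[R]_d) (zeta2 : R -> R -> 'M[R]_d) :=
  exists2 C : R, 0 <= C & forall s t : R, 0 <= s -> s <= t -> t <= T ->
    `|incr zeta s t| <= C * (t - s) `^ kappa /\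
    `|zeta2 s t| <= C * ((t - s) `^ kappa) ^+ 2.

Definition chen (zeta : R -> 'rV[R]_d) (zeta2 : R -> R -> 'M[R]_d) :=
  forall (s u t : R) (i j : 'I_d), 0 <= s -> s <= u -> u <= t -> t <= T ->
    zeta2 s t i j = zeta2 s u i j + zeta2 u t i j +
      incr zeta s u 0 i * incr zeta u t 0 j.

Context (zeta : R -> 'rV[R]_d) (zeta2 : R -> R -> 'M[R]_d).
Hypotheses (zeta_bounds : rough_path_bounds zeta zeta2) (zeta_chen : chen zeta zeta2).

Context (sigma : R -> 'rV[R]_m -> 'M[R]_(m, d)) (b : R -> 'rV[R]_m -> 'rV[R]_m).

Definition sigma_entry i k (t : R) (x : 'rV[R]_m) : R := sigma t x i k.
Local Notation sig := sigma_entry.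
Local Notation gub i k l := (derivative_along sig (sig i k) l).

(** The i-th component of the compensated increment of the rough sums for
    sigma(., x), with the derivative sigma(s, x) of x substituted. *)
Definition rough_germ (i : 'I_m) (s t : R) (x : 'rV[R]_m) : R :=
  \sum_(k < d) sig i k s x * incr zeta s t 0 k +
  \sum_(k < d) \sum_(l < d) gub i k l s x * zeta2 s t l k.

(** The space variable is frozen but the time variable is not: b is merely
    continuous in time, so (t - s) b(s, xi) would not approximate the
    integral with a power rate, whereas this expression is exactly additive
    in time. *)
Definition drift (i : 'I_m) (s t : R) (x : 'rV[R]_m) : R :=
  \int[lebesgue_measure]_(u in `[s, t]) b u x 0 i.

Definition davie_step (s t : R) (x : 'rV[R]_m) : 'rV[R]_m :=
  \row_i (drift i s t x + rough_germ i s t x).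

(** Chen's relation produces the product dzeta_su dzeta_ut, which completes the
    increment of sigma to the remainder of its first-order expansion. *)
Lemma rough_germ_defect i (s u t : R) x y : 0 <= s -> s <= u -> u <= t -> t <= T ->
  rough_germ i s u x + rough_germ i u t y - rough_germ i s t x =
  \sum_(k < d) (sig i k u y - sig i k s x -
     \sum_(l < d) gub i k l s x * incr zeta s u 0 l) * incr zeta u t 0 k +
  \sum_(k < d) \sum_(l < d) (gub i k l u y - gub i k l s x) * zeta2 u t l k.
Proof.
move=> s0 su ut tT; rewrite /rough_germ.
have -> : \sum_(k < d) sig i k s x * incr zeta s t 0 k =
    \sum_(k < d) sig i k s x * incr zeta s u 0 k +
    \sum_(k < d) sig i k s x * incr zeta u t 0 k.
  by rewrite -big_split; apply: eq_bigr => k _; rewrite /incr !mxE /=; ring.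
have -> : \sum_(k < d) \sum_(l < d) gub i k l s x * zeta2 s t l k =
    \sum_(k < d) \sum_(l < d) gub i k l s x * zeta2 s u l k +
    \sum_(k < d) \sum_(l < d) gub i k l s x * zeta2 u t l k +
    \sum_(k < d) (\sum_(l < d) gub i k l s x * incr zeta s u 0 l) * incr zeta u t 0 k.
  rewrite -!big_split /=; apply: eq_bigr => k _.
  rewrite mulr_suml -!big_split /=; apply: eq_bigr => l _.
  by rewrite (zeta_chen l k s0 su ut tT); ring.
under [in RHS]eq_bigr do rewrite !mulrBl.
under [X in _ = _ + X]eq_bigr do (under eq_bigr do rewrite mulrBl); rewrite /=.
under [X in _ = _ + X]eq_bigr do rewrite sumrB.
by rewrite !sumrB; ring.
Qed.

Hypothesis sigC : forall i k, lip_diff T (sig i k).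

Section germ_lesssim.
Context {X : Type} (s u t : X -> R).
Hypotheses (s0 : forall x, 0 <= s x) (su : forall x, s x <= u x)
  (ut : forall x, u x <= t x) (tT : forall x, t x <= T).

Let p x := (t x - s x) `^ kappa.

Lemma p_ge0 x : 0 <= p x. Proof. exact: powR_ge0. Qed.

Lemma p_lesssim1 : p <~ (fun=> 1).
Proof.
exists (T `^ kappa); first exact: powR_ge0.
move=> x; rewrite mulr1 ger0_norm ?powR_ge0// powR_le_mono//.
  by rewrite subr_ge0 (le_trans (su x)).
by rewrite (le_trans _ (tT x))// gerBl.
Qed.

Lemma times_s : times T s.
Proof. by move=> x; rewrite s0 (le_trans (su x))// (le_trans (ut x)). Qed.

Lemma times_u : times T u.
Proof. by move=> x; rewrite (le_trans _ (su x))//= (le_trans (ut x)). Qed.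

Lemma time_increment_lesssim : (fun x => u x - s x) <~ (fun x => p x ^+ 2).
Proof.
exists (T `^ (1 - 2 * kappa)); first exact: powR_ge0.
move=> x; rewrite ger0_norm ?subr_ge0//.
have h0 : 0 <= t x - s x <= T.
  by rewrite subr_ge0 (le_trans (su x))//= (le_trans _ (tT x))// gerBl.
by rewrite (le_trans _ (le_powR_sqr h0))// lerD2r.
Qed.

Lemma zeta_lesssim_su l : (fun x => incr zeta (s x) (u x) 0 l) <~ p.
Proof.
have [C C0 HC] := zeta_bounds; exists C => // x.
have [H _] := HC _ _ (s0 x) (su x) (le_trans (ut x) (tT x)).
rewrite (le_trans (coord_le_norm _ _ _))// (le_trans H)// ler_wpM2l//.
by rewrite powR_le_mono ?subr_ge0// lerD2r.
Qed.

Lemma zeta_lesssim_ut l : (fun x => incr zeta (u x) (t x) 0 l) <~ p.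
Proof.
have [C C0 HC] := zeta_bounds; exists C => // x.
have [H _] := HC _ _ (le_trans (s0 x) (su x)) (ut x) (tT x).
rewrite (le_trans (coord_le_norm _ _ _))// (le_trans H)// ler_wpM2l//.
by rewrite powR_le_mono ?subr_ge0// lerB.
Qed.

Lemma zeta2_lesssim_su l k : (fun x => zeta2 (s x) (u x) l k) <~ (fun x => p x ^+ 2).
Proof.
have [C C0 HC] := zeta_bounds; exists C => // x.
have [_ H] := HC _ _ (s0 x) (su x) (le_trans (ut x) (tT x)).
rewrite (le_trans (coord_le_norm _ _ _))// (le_trans H)// ler_wpM2l//.
rewrite lerXn2r ?nnegrE ?powR_ge0//.
by rewrite powR_le_mono ?subr_ge0// lerD2r.
Qed.

Lemma zeta2_lesssim_ut l k : (fun x => zeta2 (u x) (t x) l k) <~ (fun x => p x ^+ 2).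
Proof.
have [C C0 HC] := zeta_bounds; exists C => // x.
have [_ H] := HC _ _ (le_trans (s0 x) (su x)) (ut x) (tT x).
rewrite (le_trans (coord_le_norm _ _ _))// (le_trans H)// ler_wpM2l//.
rewrite lerXn2r ?nnegrE ?powR_ge0//.
by rewrite powR_le_mono ?subr_ge0// lerB.
Qed.

Let z x (l : 'I_d) := incr zeta (s x) (u x) 0 l.

(** Second-order expansion against a first-order increment of zeta, and
    first-order increment against the second-order area. *)
Lemma rough_germ_defect_lesssim i (xi eta : X -> 'rV[R]_m) :
  (forall j, (fun x => first_order_remainder sig s xi eta z x 0 j)
     <~ (fun x => p x ^+ 2)) ->
  (fun x => rough_germ i (s x) (u x) (xi x) + rough_germ i (u x) (t x) (eta x)
    - rough_germ i (s x) (t x) (xi x)) <~ (fun x => p x ^+ 3).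
Proof.
move=> rp; apply: lesssim_ext.
  by move=> x; rewrite rough_germ_defect.
have p30 x : 0 <= p x ^+ 3 by rewrite exprn_ge0 ?p_ge0.
apply: lesssimD; apply: lesssim_sum => // k.
  have := expansion_lesssim sigC times_s times_u p_ge0 p_lesssim1
    time_increment_lesssim zeta_lesssim_su rp (sigC i k).
  move=> /lesssimM/(_ (zeta_lesssim_ut k)).
  by apply: lesssim_extr => x; rewrite -exprSr.
apply: lesssim_sum => // l.
have us : (fun x => u x - s x) <~ p.
  exact: lesssim_trans time_increment_lesssim (sqr_lesssim p_ge0 p_lesssim1).
have ep := increment_lesssim sigC times_s p_ge0 p_lesssim1 zeta_lesssim_su rp.
have gC := bdd_lip_derivative_along sigC l (sigC i k).
have := lesssimM (lesssim_lip gC times_s times_u us ep) (zeta2_lesssim_ut l k).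
by apply: lesssim_extr => x; rewrite -exprS.
Qed.

Lemma rough_germ_defect_difference i (xi eta xi' eta' : X -> 'rV[R]_m) (E : X -> R) :
  (forall k j, lip_diff T (dspace (sig i k) j)) ->
  (forall j, (fun x => first_order_remainder sig s xi eta z x 0 j)
     <~ (fun x => p x ^+ 2)) ->
  (forall j, (fun x => first_order_remainder sig s xi' eta' z x 0 j)
     <~ (fun x => p x ^+ 2)) ->
  (forall x, 0 <= E x) ->
  (fun x => `|xi x - xi' x|) <~ E ->
  (fun x => `|eta x - eta' x|) <~ E ->
  (forall j, (fun x => first_order_remainder sig s xi eta z x 0 j
     - first_order_remainder sig s xi' eta' z x 0 j)
     <~ (fun x => E x * p x ^+ 2)) ->
  (fun x => (rough_germ i (s x) (u x) (xi x) + rough_germ i (u x) (t x) (eta x)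
    - rough_germ i (s x) (t x) (xi x)) -
    (rough_germ i (s x) (u x) (xi' x) + rough_germ i (u x) (t x) (eta' x)
    - rough_germ i (s x) (t x) (xi' x))) <~ (fun x => E x * p x ^+ 3).
Proof.
move=> sigC' rp rp' E0 xiE etaE rE.
have Ep0 n x : 0 <= E x * p x ^+ n by rewrite mulr_ge0 ?exprn_ge0 ?p_ge0.
pose G1 (v w : X -> 'rV[R]_m) k x := sig i k (u x) (v x) - sig i k (s x) (w x) -
     \sum_(l < d) gub i k l (s x) (w x) * z x l.
pose G2 (v w : X -> 'rV[R]_m) k l x := gub i k l (u x) (v x) - gub i k l (s x) (w x).
apply: (@lesssim_ext _ _ _ (fun x =>
   \sum_(k < d) (G1 eta xi k x - G1 eta' xi' k x) * incr zeta (u x) (t x) 0 k +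
   \sum_(k < d) \sum_(l < d) (G2 eta xi k l x - G2 eta' xi' k l x)
      * zeta2 (u x) (t x) l k)).
  move=> x; rewrite !rough_germ_defect// opprD addrACA -!sumrB; congr (_ + _).
    by apply: eq_bigr => k _; rewrite [RHS]mulrBl.
  apply: eq_bigr => k _; rewrite -sumrB; apply: eq_bigr => l _.
  by rewrite [RHS]mulrBl.
have EpS n x : E x * p x ^+ n * p x = E x * p x ^+ n.+1 by rewrite exprSr mulrA.
apply: lesssimD; apply: lesssim_sum => // k.
  have := expansion_difference_lesssim sigC times_s times_u p_ge0 p_lesssim1
    time_increment_lesssim zeta_lesssim_su rp rp' E0 xiE etaE rE (sigC i k) (sigC' k).
  move=> /lesssimM/(_ (zeta_lesssim_ut k)).
  by apply: lesssim_extr => x; rewrite -EpS.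
apply: lesssim_sum => // l.
have := derivative_along_difference sigC times_s times_u p_ge0 p_lesssim1
    time_increment_lesssim zeta_lesssim_su rp rp' E0 xiE etaE rE l (sigC i k) (sigC' k).
move=> /lesssimM/(_ (zeta2_lesssim_ut l k)).
by apply: lesssim_extr => x; rewrite -mulrA -exprS.
Qed.

End germ_lesssim.
End germ.

(** * The one-step expansion and its composition defect *)

Section drift.
Context {R : realType} {m : nat} (T : R) (b : R -> 'rV[R]_m -> 'rV[R]_m).

Definition drift_bounds := exists2 C : R, 0 <= C &
  forall i (t : R) x y, 0 <= t <= T ->
    `|b t x 0 i| <= C /\ `|b t x 0 i - b t y 0 i| <= C * `|x - y|.

Hypothesis b_continuous : forall i,
  {within slab T, continuous (fun p : R * 'rV[R]_m => b p.1 p.2 0 i)}.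
Hypothesis b_bounds : drift_bounds.

Lemma drift_continuous i (gamma : R -> 'rV[R]_m) :
  {within `[0, T], continuous gamma} ->
  {within `[0, T], continuous (fun u => b u (gamma u) 0 i)}.
Proof.
exact: (@within_slab_continuous R m T 0 T (fun t x => b t x 0 i)).
Qed.

Lemma drift_continuous_cst i (xi : 'rV[R]_m) :
  {within `[0, T], continuous (fun u => b u xi 0 i)}.
Proof.
apply: (@drift_continuous i (fun=> xi)).
exact/continuous_subspaceT/cst_continuous.
Qed.

Section elements.
Context {X : Type} (s u t : X -> R).
Hypotheses (s0 : forall x, 0 <= s x) (su : forall x, s x <= u x)
  (ut : forall x, u x <= t x) (tT : forall x, t x <= T).

Lemma drift_lesssim i (xi : X -> 'rV[R]_m) :
  (fun x => drift b i (s x) (t x) (xi x)) <~ (fun x => t x - s x).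
Proof.
have [C C0 HC] := b_bounds; exists C => // x.
have st := le_trans (su x) (ut x).
rewrite /drift; apply: (Rintegral_bound (s0 x) st (tT x) (@drift_continuous_cst i (xi x))) => v /andP[sv vt].
by have [] := HC i v (xi x) (xi x); rewrite ?(le_trans (s0 x) sv) ?(le_trans vt (tT x)).
Qed.

Lemma drift_lip_lesssim i (xi eta : X -> 'rV[R]_m) :
  (fun x => drift b i (s x) (t x) (xi x) - drift b i (s x) (t x) (eta x))
   <~ (fun x => (t x - s x) * `|xi x - eta x|).
Proof.
have [C C0 HC] := b_bounds; exists C => // x.
have st := le_trans (su x) (ut x).
rewrite mulrCA mulrC /drift; apply: (Rintegral_dist (s0 x) st (tT x)
  (@drift_continuous_cst i (xi x)) (@drift_continuous_cst i (eta x))) => v /andP[sv vt].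
by have [] := HC i v (xi x) (eta x); rewrite ?(le_trans (s0 x) sv) ?(le_trans vt (tT x)).
Qed.

(** The additive part of the drift cancels and only the change of the frozen
    point remains. *)
Lemma drift_defect i (xi eta : X -> 'rV[R]_m) x :
  drift b i (s x) (u x) (xi x) + drift b i (u x) (t x) (eta x)
    - drift b i (s x) (t x) (xi x) =
  drift b i (u x) (t x) (eta x) - drift b i (u x) (t x) (xi x).
Proof.
rewrite [drift b i (s x) (t x) _](Rintegral_chasles (s0 x) (su x) (ut x) (tT x)
  (@drift_continuous_cst i (xi x))) -/(drift b i (s x) (u x) (xi x))
  -/(drift b i (u x) (t x) (xi x)); ring.
Qed.

End elements.
End drift.

Section davie.
Context {R : realType} {m d : nat} (T kappa : R).
Hypotheses (kappa_gt0 : 0 < kappa) (kappa_le : kappa <= 2^-1).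
Context (zeta : R -> 'rV[R]_d) (zeta2 : R -> R -> 'M[R]_d).
Hypotheses (zeta_bounds : rough_path_bounds T kappa zeta zeta2)
  (zeta_chen : chen T zeta zeta2).
Context (sigma : R -> 'rV[R]_m -> 'M[R]_(m, d)) (b : R -> 'rV[R]_m -> 'rV[R]_m).
Hypothesis sigC : forall i k, lip_diff T (sigma_entry sigma i k).
Hypothesis b_continuous : forall i,
  {within slab T, continuous (fun p : R * 'rV[R]_m => b p.1 p.2 0 i)}.
Hypothesis b_bounds : drift_bounds T b.

Local Notation sig := (sigma_entry sigma).
Local Notation gub i k l := (derivative_along sig (sig i k) l).
Local Notation step := (davie_step zeta zeta2 sigma b).
Local Notation germ := (rough_germ zeta zeta2 sigma).

Section elements.
Context {X : Type} (s u t : X -> R).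
Hypotheses (s0 : forall x, 0 <= s x) (su : forall x, s x <= u x)
  (ut : forall x, u x <= t x) (tT : forall x, t x <= T).

Let p x := (t x - s x) `^ kappa.
Let p20 x : 0 <= p x ^+ 2. Proof. by rewrite exprn_ge0 ?powR_ge0. Qed.
Let p30 x : 0 <= p x ^+ 3. Proof. by rewrite exprn_ge0 ?powR_ge0. Qed.
Let z x (l : 'I_d) := incr zeta (s x) (u x) 0 l.

Lemma area_term_lesssim i (xi : X -> 'rV[R]_m) :
  (fun x => \sum_(k < d) \sum_(l < d) gub i k l (s x) (xi x) * zeta2 (s x) (u x) l k)
    <~ (fun x => p x ^+ 2).
Proof.
apply: lesssim_sum => // k; apply: lesssim_sum => // l.
apply: lesssimMl; last exact: (zeta2_lesssim_su kappa_gt0 zeta_bounds s0 su ut tT).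
apply: (lesssim_bounded xi (bdd_lip_derivative_along sigC l (sigC i k))).
exact: (times_s s0 su ut tT).
Qed.

(** The drift and the area term of the step are of second order. *)
Lemma first_order_remainder_lesssim (xi eta : X -> 'rV[R]_m) :
  (fun x => `|eta x - xi x - step (s x) (u x) (xi x)|) <~ (fun x => p x ^+ 2) ->
  forall j, (fun x => first_order_remainder sig s xi eta z x 0 j)
     <~ (fun x => p x ^+ 2).
Proof.
move=> rp j; apply: (@lesssim_ext _ _ _ (fun x =>
  (eta x - xi x - step (s x) (u x) (xi x)) 0 j +
  (drift b j (s x) (u x) (xi x) +
   \sum_(k < d) \sum_(l < d) gub j k l (s x) (xi x) * zeta2 (s x) (u x) l k))).
  by move=> x; rewrite /first_order_remainder !mxE /rough_germ /z; ring.
apply: lesssimD; [|apply: lesssimD; last exact: area_term_lesssim].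
  have [C C0 HC] := rp; exists C => // x.
  by apply: le_trans (HC x); rewrite normr_id coord_le_norm.
apply: lesssim_trans (time_increment_lesssim kappa_le s0 su ut tT).
by apply: (drift_lesssim b_continuous b_bounds (u := s)) => // x;
  exact: le_trans (ut x) (tT x).
Qed.

Lemma davie_step_defect_lesssim (xi eta : X -> 'rV[R]_m) :
  (fun x => `|eta x - xi x - step (s x) (u x) (xi x)|) <~ (fun x => p x ^+ 2) ->
  (fun x => `|step (s x) (u x) (xi x) + step (u x) (t x) (eta x)
     - step (s x) (t x) (xi x)|) <~ (fun x => p x ^+ 3).
Proof.
move=> H; have rp := first_order_remainder_lesssim H.
apply: lesssim_mx => // i j; rewrite ord1.
apply: (@lesssim_ext _ _ _ (fun x =>
  (drift b j (u x) (t x) (eta x) - drift b j (u x) (t x) (xi x)) +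
  (germ j (s x) (u x) (xi x) + germ j (u x) (t x) (eta x)
    - germ j (s x) (t x) (xi x)))).
  by move=> x; rewrite -(drift_defect b_continuous s0 su ut tT) !mxE; ring.
apply: lesssimD; last exact: (rough_germ_defect_lesssim kappa_gt0 kappa_le
  zeta_bounds zeta_chen sigC s0 su ut tT).
have tu : (fun x => t x - u x) <~ (fun x => p x ^+ 2).
  apply: lesssim_trans (time_increment_lesssim kappa_le s0 _ _ tT).
  - apply: lesssim_le => x; rewrite ger0_norm ?subr_ge0//.
    exact: lerB.
  - by move=> x; exact: le_trans (ut x).
  - by [].
have p0 x : 0 <= p x by exact: powR_ge0.
have ep := increment_lesssim sigC (times_s s0 su ut tT) p0
  (p_lesssim1 kappa_gt0 s0 su ut tT) (zeta_lesssim_su kappa_gt0 zeta_bounds s0 su ut tT) rp.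
apply: (@lesssim_trans _ _ (fun x => (t x - u x) * `|eta x - xi x|)).
  apply: (drift_lip_lesssim b_continuous b_bounds (u := u)) => // x.
  exact: le_trans (s0 x) (su x).
by apply: lesssim_extr (lesssimM tu ep) => x; rewrite -exprSr.
Qed.

Lemma davie_step_lesssim (xi : X -> 'rV[R]_m) :
  (fun x => `|step (s x) (u x) (xi x)|) <~ p.
Proof.
have p0 x : 0 <= p x by exact: powR_ge0.
have p1 := p_lesssim1 kappa_gt0 s0 su ut tT.
apply: lesssim_mx => // i j; rewrite ord1.
apply: (@lesssim_ext _ _ _ (fun x => drift b j (s x) (u x) (xi x) +
  (\sum_(k < d) sig j k (s x) (xi x) * z x k +
  \sum_(k < d) \sum_(l < d) gub j k l (s x) (xi x) * zeta2 (s x) (u x) l k))).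
  by move=> x; rewrite !mxE.
apply: lesssimD; last apply: lesssimD.
- apply: lesssim_trans (sqr_lesssim p0 p1).
  apply: lesssim_trans (time_increment_lesssim kappa_le s0 su ut tT).
  by apply: (drift_lesssim b_continuous b_bounds (u := s)) => // x;
    exact: le_trans (ut x) (tT x).
- apply: lesssim_sum => // k; apply: lesssimMl; last exact: (zeta_lesssim_su kappa_gt0 zeta_bounds s0 su ut tT).
  have [sC _ _] := sigC j k.
  exact: (lesssim_bounded xi sC (times_s s0 su ut tT)).
- exact: lesssim_trans (area_term_lesssim j xi) (sqr_lesssim p0 p1).
Qed.

Lemma area_term_lip_lesssim i (xi eta : X -> 'rV[R]_m) :
  (fun x => \sum_(k < d) \sum_(l < d) gub i k l (s x) (eta x) * zeta2 (s x) (u x) l k -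
    \sum_(k < d) \sum_(l < d) gub i k l (s x) (xi x) * zeta2 (s x) (u x) l k)
    <~ (fun x => `|eta x - xi x| * p x ^+ 2).
Proof.
have sT := times_s s0 su ut tT.
have ep20 x : 0 <= `|eta x - xi x| * p x ^+ 2 by rewrite mulr_ge0.
apply: (@lesssim_ext _ _ _ (fun x => \sum_(k < d) \sum_(l < d)
    (gub i k l (s x) (eta x) - gub i k l (s x) (xi x)) * zeta2 (s x) (u x) l k)).
  move=> x; rewrite -sumrB; apply: eq_bigr => k _; rewrite -sumrB.
  by apply: eq_bigr => l _; rewrite mulrBl.
apply: lesssim_sum => // k; apply: lesssim_sum => // l.
apply: lesssimM; last exact: (zeta2_lesssim_su kappa_gt0 zeta_bounds s0 su ut tT).
apply: (lesssim_lip_space (bdd_lip_derivative_along sigC l (sigC i k)) sT) => //.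
exact: lesssim_refl.
Qed.

Lemma rough_germ_lip_lesssim i (xi eta : X -> 'rV[R]_m) :
  (fun x => germ i (s x) (u x) (eta x) - germ i (s x) (u x) (xi x))
    <~ (fun x => `|eta x - xi x| * p x).
Proof.
have sT := times_s s0 su ut tT.
have p0 x : 0 <= p x by exact: powR_ge0.
have p1 := p_lesssim1 kappa_gt0 s0 su ut tT.
have e0 : (fun x => `|eta x - xi x|) <~ (fun x => `|eta x - xi x|) by exact: lesssim_refl.
have ep0 x : 0 <= `|eta x - xi x| * p x by rewrite mulr_ge0.
apply: (@lesssim_ext _ _ _ (fun x =>
  \sum_(k < d) (sig i k (s x) (eta x) - sig i k (s x) (xi x)) * z x k +
  (\sum_(k < d) \sum_(l < d) gub i k l (s x) (eta x) * zeta2 (s x) (u x) l k -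
    \sum_(k < d) \sum_(l < d) gub i k l (s x) (xi x) * zeta2 (s x) (u x) l k))).
  move=> x; rewrite /rough_germ.
  have -> : \sum_(k < d) (sig i k (s x) (eta x) - sig i k (s x) (xi x)) * z x k =
      \sum_(k < d) sig i k (s x) (eta x) * z x k -
      \sum_(k < d) sig i k (s x) (xi x) * z x k.
    by rewrite -sumrB; apply: eq_bigr => k _; rewrite mulrBl.
  by rewrite /z; ring.
apply: lesssimD; last first.
  apply: lesssim_trans (area_term_lip_lesssim i xi eta) _.
  exact: lesssimM e0 (sqr_lesssim p0 p1).
apply: lesssim_sum => // k; have [sC _ _] := sigC i k.
apply: lesssimM; first exact: (lesssim_lip_space sC sT _ e0).
exact: (zeta_lesssim_su kappa_gt0 zeta_bounds s0 su ut tT).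
Qed.

Lemma davie_step_lip_lesssim (xi eta : X -> 'rV[R]_m) :
  (fun x => `|step (s x) (u x) (eta x) - step (s x) (u x) (xi x)|)
    <~ (fun x => `|eta x - xi x|).
Proof.
have p0 x : 0 <= p x by exact: powR_ge0.
have p1 := p_lesssim1 kappa_gt0 s0 su ut tT.
have ee : (fun x => `|eta x - xi x|) <~ (fun x => `|eta x - xi x|).
  exact: lesssim_refl.
apply: lesssim_mx => // i j; rewrite ord1.
apply: (@lesssim_ext _ _ _ (fun x =>
  (drift b j (s x) (u x) (eta x) - drift b j (s x) (u x) (xi x)) +
  (germ j (s x) (u x) (eta x) - germ j (s x) (u x) (xi x)))).
  by move=> x; rewrite !mxE; ring.
apply: lesssimD; last first.
  exact: lesssim_trans (rough_germ_lip_lesssim j xi eta) (lesssimMr ee p1).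
apply: (@lesssim_trans _ _ (fun x => (u x - s x) * `|eta x - xi x|)).
  apply: (drift_lip_lesssim b_continuous b_bounds (u := s)) => // x.
  exact: le_trans (ut x) (tT x).
apply: lesssimMl => //.
have us := time_increment_lesssim kappa_le s0 su ut tT.
exact: lesssim_trans us (lesssim_trans (sqr_lesssim p0 p1) p1).
Qed.

End elements.

(** The constant does not depend on how close y is to the expansion, as long as
    the error is of second order. This lets the sewing constant be chosen
    before the length scale on which the Euler scheme is controlled. *)
Lemma davie_step_defect : exists2 K : R, 0 <= K &
  forall (s u t : R) x y, 0 <= s -> s <= u -> u <= t -> t <= T ->
    `|y - x - step s u x| <= ((u - s) `^ kappa) ^+ 2 ->
    `|step s u x + step u t y - step s t x| <= K * ((t - s) `^ kappa) ^+ 3.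
Proof.
(* All admissible (s, u, t, xi, eta). *)
pose X := {q : (R * R * R) * ('rV[R]_m * 'rV[R]_m) |
  [/\ 0 <= q.1.1.1, q.1.1.1 <= q.1.1.2, q.1.1.2 <= q.1.2, q.1.2 <= T &
  `|q.2.2 - q.2.1 - step q.1.1.1 q.1.1.2 q.2.1| <=
    ((q.1.1.2 - q.1.1.1) `^ kappa) ^+ 2]}.
have [|||||K K0 HK] := @davie_step_defect_lesssim X (fun q => (sval q).1.1.1)
  (fun q => (sval q).1.1.2) (fun q => (sval q).1.2) _ _ _ _
  (fun q => (sval q).2.1) (fun q => (sval q).2.2).
- by case=> q [].
- by case=> q [].
- by case=> q [].
- by case=> q [].
- apply: lesssim_le => -[q [? su ut ? H]] /=; rewrite normr_id (le_trans H)//.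
  rewrite lerXn2r ?nnegrE ?powR_ge0// powR_le_mono ?subr_ge0// lerD2r//.
exists K => // s u t x y s0 su ut tT H.
have P : [/\ 0 <= s, s <= u, u <= t, t <= T &
  `|y - x - step s u x| <= ((u - s) `^ kappa) ^+ 2] by [].
by have := HK (exist _ ((s, u, t), (x, y)) P); rewrite /= normr_id.
Qed.

Lemma davie_step_bound : exists2 K : R, 0 <= K &
  forall (s t : R) x, 0 <= s -> s <= t -> t <= T ->
    `|step s t x| <= K * (t - s) `^ kappa.
Proof.
pose X := {q : R * R * 'rV[R]_m | [/\ 0 <= q.1.1, q.1.1 <= q.1.2 & q.1.2 <= T]}.
have [||||K K0 HK] := @davie_step_lesssim X (fun q => (sval q).1.1)
  (fun q => (sval q).1.2) (fun q => (sval q).1.2) _ _ _ _ (fun q => (sval q).2).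
- by case=> q [].
- by case=> q [].
- by [].
- by case=> q [].
exists K => // s t x s0 st tT.
have P : [/\ 0 <= s, s <= t & t <= T] by [].
by have := HK (exist _ (s, t, x) P); rewrite /= normr_id.
Qed.

Lemma davie_step_lip : exists2 K : R, 0 <= K &
  forall (s t : R) x y, 0 <= s -> s <= t -> t <= T ->
    `|step s t y - step s t x| <= K * `|y - x|.
Proof.
pose X := {q : R * R * ('rV[R]_m * 'rV[R]_m) | [/\ 0 <= q.1.1, q.1.1 <= q.1.2 & q.1.2 <= T]}.
have [||||K K0 HK] := @davie_step_lip_lesssim X (fun q => (sval q).1.1)
  (fun q => (sval q).1.2) (fun q => (sval q).1.2) _ _ _ _
  (fun q => (sval q).2.1) (fun q => (sval q).2.2).
- by case=> q [].
- by case=> q [].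
- by [].
- by case=> q [].
exists K => // s t x y s0 st tT.
have P : [/\ 0 <= s, s <= t & t <= T] by [].
by have := HK (exist _ (s, t, (x, y)) P); rewrite /= normr_id.
Qed.

Lemma davie_step_diag (t : R) x : 0 <= t <= T -> step t t x = 0.
Proof.
move=> /andP[t0 tT]; have [K K0 HK] := davie_step_bound.
apply/eqP; rewrite -normr_eq0 eq_le normr_ge0 andbT.
by rewrite (le_trans (HK t t x t0 (lexx t) tT))// subrr powR0 ?gt_eqF// mulr0.
Qed.

End davie.

(** * Pointwise compactness *)

Section compactness.
Context {R : realType} {m : nat} {I : choiceType}.

Lemma closed_ball_compact (y : 'rV[R]_m) (M : R) :
  compact [set v : 'rV[R]_m | `|v - y| <= M].
Proof.
have [M0|M0] := ltP M 0.
  rewrite (_ : mkset _ = set0); first exact: compact0.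
  rewrite -subset0 => v /= vM.
  by have := le_lt_trans vM M0; rewrite ltNge normr_ge0.
have -> : [set v : 'rV[R]_m | `|v - y| <= M] =
    [set v : 'rV[R]_m | forall j, [set` `[y 0 j - M, y 0 j + M]] (v ord0 j)].
  rewrite eqEsubset; split => v /= H.
    move=> j; rewrite in_itv/= -ler_distl.
    by have := coord_le_norm (v - y) 0 j; rewrite !mxE => /le_trans; apply.
  apply: mx_norm_le => // i j; rewrite ord1 !mxE ler_distl.
  by have := H j; rewrite in_itv.
apply: (@rV_compact _ _ (fun j : 'I_m => [set` `[y 0 j - M, y 0 j + M]])) => j.
exact: segment_compact.
Qed.

(** By Tychonoff's theorem the families with values in prescribed balls form a
    compact set for pointwise convergence. A closed constraint on two values
    defines a closed set for this topology, so constraints that can be met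
    for every finite set of indices can be met together. *)
Lemma pointwise_compactness (y : 'rV[R]_m) (M : I -> R)
    (D : set (I * I)) (P : I * I -> set ('rV[R]_m * 'rV[R]_m)) :
  (forall q, D q -> closed (P q)) ->
  (forall S : seq I, exists x : I -> 'rV[R]_m, (forall i, `|x i - y| <= M i) /\
    forall i j, i \in S -> j \in S -> D (i, j) -> P (i, j) (x i, x j)) ->
  exists x : I -> 'rV[R]_m, (forall i, `|x i - y| <= M i) /\
    forall i j, D (i, j) -> P (i, j) (x i, x j).
Proof.
move=> clP ex.
pose A := [set x : prod_topology (fun _ : I => 'rV[R]_m) | forall i,
  [set v : 'rV[R]_m | `|v - y| <= M i] (x i)].
have cA : compact A.
  apply: (@tychonoff I (fun=> 'rV[R]_m) (fun i => [set v | `|v - y| <= M i])) => i.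
  exact: closed_ball_compact.
pose g (q : I * I) := [set x : prod_topology (fun _ : I => 'rV[R]_m) | P q (x q.1, x q.2)].
have clg q : D q -> closed (g q).
  move=> Dq.
  apply: (@preimage_closed _ _
    (fun x : prod_topology (fun _ : I => 'rV[R]_m) => (x q.1, x q.2))).
    move=> x _; have c1 := @proj_continuous I (fun=> 'rV[R]_m) q.1 x.
    have c2 := @proj_continuous I (fun=> 'rV[R]_m) q.2 x.
    have c12 := cvg_pair c1 c2.
    by apply: c12; exact: (nbhs_filter (x : prod_topology (fun _ : I => 'rV[R]_m))).
  exact: clP Dq.
have [S0|/set0P[q0 Dq0]] := eqVneq D set0.
  have [x [xM _]] := ex [::]; exists x; split => // i j.
  by rewrite S0.
pose f (q : I * I) := A `&` g q.
have finIf : finI D f.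
  move=> D' D'D.
  have [x [xM xP]] := ex (map fst (finmap.enum_fset D') ++ map snd (finmap.enum_fset D')).
  exists x => -[i j] /= ijD'; split => //; apply: xP.
  - by rewrite mem_cat (map_f fst (x := (i, j))).
  - by rewrite mem_cat (map_f snd (x := (i, j))) ?orbT.
  - by have := D'D _ ijD'; rewrite inE.
have [|x [Ax clx]] := cA _ (finI_filter finIf).
  by exists (f q0); [exact: finI_from1|move=> ? []].
exists x; split => // i j Dij; apply: (clg (i, j) Dij) => B nB.
by apply: clx nB; exists (f (i, j)); [exact: finI_from1|move=> ? []].
Qed.

End compactness.

(** * Bounds for chains of increments *)

(** The choice of a length scale that absorbs a given constant. *)
Lemma small_power {R : realType} (kappa C : R) : 0 < kappa -> 0 <= C ->
  exists2 delta : R, 0 < delta & C * delta `^ kappa <= 1.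
Proof.
move=> k0 C0; exists ((1 + C)^-1 `^ (kappa^-1)).
  by rewrite powR_gt0// invr_gt0 ltr_pwDl.
have C1 : 0 < 1 + C by rewrite ltr_pwDl.
rewrite -powRrM mulVf ?gt_eqF// powRr1; last by rewrite invr_ge0 ltW.
by rewrite ler_pdivrMr// mul1r lerDr.
Qed.

Section chain.
Context {R : realType} {V : normedModType R}.

(** Single steps may be longer than delta, so a long interval is cut into pieces
    of length at most delta, each followed by one more step. *)
Lemma chain_bound (t : nat -> R) (X : nat -> V) (delta M : R) :
  nondecreasing_seq t -> 0 <= delta -> 0 <= M ->
  (forall k, `|X k.+1 - X k| <= M) ->
  (forall k l, (k <= l)%N -> t l - t k <= delta -> `|X l - X k| <= M) ->
  forall n k l, (k <= l)%N -> t l - t k <= n%:R * delta ->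
    `|X l - X k| <= (2 * n.+1)%:R * M.
Proof.
move=> nt d0 M0 X1 Xd; have M2 n : M <= (2 * n.+1)%:R * M.
  by rewrite ler_peMl// ler1n muln_gt0.
elim=> [|n IH] k l kl tkl.
  by apply: le_trans (M2 0); apply: Xd => //; rewrite (le_trans tkl)// mul0r.
have [tkld|dtkl] := leP (t l - t k) delta.
  by apply: le_trans (M2 _); exact: Xd.
have {}kl : (k < l)%N.
  by rewrite ltn_neqAle kl andbT; apply/eqP => klE; move: dtkl; rewrite klE subrr ltNge d0.
have [j [kj jl tj tj1]] := split_nondecreasing nt d0 kl.
have Xkj := Xd _ _ kj tj.
have Xkj1 : `|X j.+1 - X k| <= 2 * M.
  rewrite -(subrKA (X j)) (le_trans (ler_normD _ _))// mulr_natl mulr2n.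
  by rewrite lerD.
have [jl1|lj] := ltnP j.+1 l; last first.
  have -> : l = j.+1 by apply/eqP; rewrite eqn_leq lj jl.
  by rewrite (le_trans Xkj1)// ler_wpM2r// ler_nat leq_pmulr.
have := IH j.+1 l (ltnW jl1).
have tjl : t l - t j.+1 <= n%:R * delta.
  have := tj1 jl1; move: tkl; rewrite -natr1 mulrDl mul1r.
  by move: (t l) (t k) (t j.+1) (n%:R * delta) => a c e f; clear; lra.
move=> /(_ tjl) Xjl.
rewrite -(subrKA (X j.+1)) (le_trans (ler_normD _ _))//.
rewrite -[n.+2]addn1 mulnDr muln1 natrD mulrDl.
exact: lerD.
Qed.

End chain.

(** * The Euler scheme *)

Section times.
Context {R : realType} (T : R).
Implicit Types (S : seq R).

(** The sorted times of S preceded by 0 and continued by the constant T: the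
    latter keeps the sequence nondecreasing and inside [0, T] at every
    index. *)
Definition time_of S (k : nat) : R := nth T (0 :: sort <=%O S) k.
Definition index_of S (t : R) : nat := index t (0 :: sort <=%O S).

Lemma index_of0 S : index_of S 0 = 0%N.
Proof. by rewrite /index_of /= eqxx. Qed.

Lemma time_of_index S t : t \in S -> time_of S (index_of S t) = t.
Proof. by move=> tS; rewrite /time_of /index_of nth_index// in_cons mem_sort tS orbT. Qed.

Hypothesis T0 : 0 < T.

Lemma time_of_bounds S k : (forall t, t \in S -> 0 <= t <= T) ->
  0 <= time_of S k <= T.
Proof.
move=> ST; rewrite /time_of.
have [kS|kS] := ltnP k (size (0 :: sort <=%O S)).
  have := mem_nth T kS; rewrite in_cons => /predU1P[->|].
    by rewrite lexx ltW.
  by rewrite mem_sort; exact: ST.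
by rewrite nth_default// lexx ltW.
Qed.

Lemma time_of_nondecreasing S : (forall t, t \in S -> 0 <= t <= T) ->
  nondecreasing_seq (time_of S).
Proof.
move=> ST; apply/nondecreasing_seqP => k.
have [kS|kS] := ltnP k.+1 (size (0 :: sort <=%O S)).
  have : sorted <=%O (0 :: sort <=%O S).
    rewrite /= path_min_sorted ?sort_le_sorted//.
    by apply/allP => t; rewrite mem_sort => /ST/andP[].
  by move=> /(sortedP T)/(_ k kS).
rewrite [X in _ <= X]/time_of nth_default//.
by have /andP[] := time_of_bounds k ST.
Qed.

Lemma index_of_mono S (s t : R) : (forall t, t \in S -> 0 <= t <= T) ->
  s \in S -> t \in S -> s <= t -> (index_of S s <= index_of S t)%N.
Proof.
move=> ST sS tS st; rewrite leqNgt; apply/negP => ts.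
have := time_of_nondecreasing ST (ltnW ts).
rewrite !time_of_index// => st'; have E : s = t by apply/eqP; rewrite eq_le st st'.
by move: ts; rewrite E ltnn.
Qed.

End times.

Section euler.
Context {R : realType} {m d : nat} (T kappa : R).
Hypotheses (T0 : 0 < T) (kappa3 : 3^-1 < kappa) (kappa_le : kappa <= 2^-1).
Context (zeta : R -> 'rV[R]_d) (zeta2 : R -> R -> 'M[R]_d).
Hypotheses (zeta_bounds : rough_path_bounds T kappa zeta zeta2)
  (zeta_chen : chen T zeta zeta2).
Context (sigma : R -> 'rV[R]_m -> 'M[R]_(m, d)) (b : R -> 'rV[R]_m -> 'rV[R]_m).
Hypothesis sigC : forall i k, lip_diff T (sigma_entry sigma i k).
Hypothesis b_continuous : forall i,
  {within slab T, continuous (fun p : R * 'rV[R]_m => b p.1 p.2 0 i)}.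
Hypothesis b_bounds : drift_bounds T b.

Local Notation step := (davie_step zeta zeta2 sigma b).

Let kappa_gt0 : 0 < kappa. Proof. by apply: lt_trans kappa3; rewrite invr_gt0. Qed.

Let theta := kappa * 3%:R.

Let theta_gt1 : 1 < theta.
Proof. by rewrite /theta -ltr_pdivrMr// mul1r. Qed.

Lemma powR_theta (h : R) : h `^ theta = (h `^ kappa) ^+ 3.
Proof. by rewrite /theta powRrM powR_mulrn ?powR_ge0. Qed.

Fixpoint euler (t : nat -> R) (y : 'rV[R]_m) (n : nat) : 'rV[R]_m :=
  if n is k.+1 then euler t y k + step (t k) (t k.+1) (euler t y k) else y.

(** Sewing applied to the distance between the scheme and its one-step
    expansion. The scale delta is such that C (t - s)^theta <= (t - s)^(2
    kappa) for t - s <= delta, which is the closeness required to bound the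
    composition defect. *)
Lemma euler_local : exists C delta : R, [/\ 0 <= C, 0 < delta &
  forall (t : nat -> R) (y : 'rV[R]_m), nondecreasing_seq t ->
  (forall k, 0 <= t k <= T) ->
  forall k l, (k <= l)%N -> t l - t k <= delta ->
  `|euler t y l - euler t y k - step (t k) (t l) (euler t y k)|
    <= C * ((t l - t k) `^ kappa) ^+ 3].
Proof.
have [K K0 HK] := davie_step_defect kappa_gt0 kappa_le zeta_bounds zeta_chen
  sigC b_continuous b_bounds.
pose C := sewing_constant theta K.
have C0 : 0 <= C by exact: sewing_constant_ge0.
have [delta d0 Cd] := small_power kappa_gt0 C0.
exists C, delta; split => // t y nt tT k l kl tkl.
pose A k l := `|euler t y l - euler t y k - step (t k) (t l) (euler t y k)|.
rewrite -powR_theta; apply: (discrete_sewing theta_gt1 (A := A) nt K0) kl tkl.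
- by move=> j; rewrite /A (davie_step_diag kappa_gt0 kappa_le zeta_bounds sigC
    b_continuous b_bounds)// subrr subr0 normr0.
- by move=> j; rewrite /A /= addrAC addrK subrr normr0.
- move=> {}k j {}l kj jl tkl AC.
  have tkj : t k <= t j by exact: nt.
  have tjl : t j <= t l by exact: nt.
  have /andP[tk0 _] := tT k; have /andP[_ tlT] := tT l.
  set q := (t j - t k) `^ kappa.
  have q0 : 0 <= q by exact: powR_ge0.
  have Aq : A k j <= q ^+ 2.
    apply: le_trans AC _; rewrite powR_theta -/C -/q exprS mulrA.
    rewrite ler_piMl ?exprn_ge0// (le_trans _ Cd)// ler_wpM2l//.
    apply: (powR_le_mono kappa_gt0); first by rewrite subr_ge0.
    by apply: le_trans tkl; rewrite lerD2r.
  have := HK _ _ _ _ _ tk0 tkj tjl tlT Aq; rewrite -powR_theta => HKq.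
  rewrite -addrA (le_trans _ (lerD (lexx _) (lerD (lexx _) HKq)))//.
  rewrite /A; set x := euler t y l; set v := euler t y k; set w := euler t y j.
  apply: le_trans (lerD (lexx _) (ler_normD _ _)).
  apply: le_trans (ler_normD _ _).
  rewrite le_eqVlt; apply/orP; left; apply/eqP; congr (`|_|).
  by apply/rowP => i; rewrite !mxE; ring.
Qed.

(** The constraint for (s, t) is the bound of the Euler scheme between these
    times. It is met for finitely many pairs by the scheme along all the
    times involved. *)
Lemma davie_solution_local (y : 'rV[R]_m) : exists (x : R -> 'rV[R]_m) (C delta M : R),
  [/\ 0 <= C, 0 < delta, x 0 = y, (forall t, `|x t - y| <= M) &
  forall s t : R, 0 <= s -> s <= t -> t <= T -> t - s <= delta ->
  `|x t - x s - step s t (x s)| <= C * ((t - s) `^ kappa) ^+ 3].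
Proof.
have [C [delta [C0 d0 HC]]] := euler_local.
have [K K0 HK] := davie_step_bound kappa_gt0 kappa_le zeta_bounds sigC
  b_continuous b_bounds.
pose M1 := C * (T `^ kappa) ^+ 3 + K * T `^ kappa.
have M10 : 0 <= M1 by rewrite addr_ge0// mulr_ge0// ?exprn_ge0 ?powR_ge0.
have [n nT] : exists n : nat, T <= n%:R * delta.
  exists (Num.bound (T / delta)); rewrite -ler_pdivrMr//.
  by apply/ltW/archi_boundP; rewrite divr_ge0// ltW.
pose M := (2 * n.+1)%:R * M1.
have M0 : 0 <= M by rewrite mulr_ge0.
have powT (s t : R) : 0 <= s -> s <= t -> t <= T -> (t - s) `^ kappa <= T `^ kappa.
  move=> s0 st tT; apply: (powR_le_mono kappa_gt0); first by rewrite subr_ge0.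
  by rewrite (le_trans _ tT)// gerBl.
have euler_bounded (t : nat -> R) : nondecreasing_seq t -> (forall k, 0 <= t k <= T) ->
    forall k, `|euler t y k - y| <= M.
  move=> nt tT k; apply: (chain_bound (X := euler t y) nt (ltW d0) M10 _ _ (leq0n k)).
  - move=> j; rewrite /= addrAC subrr add0r.
    have /andP[tj _] := tT j; have /andP[_ tj1] := tT j.+1.
    have tjj : t j <= t j.+1 by exact: nt.
    rewrite (le_trans (HK _ _ _ tj tjj tj1))// /M1.
    rewrite -[leLHS]add0r lerD ?mulr_ge0 ?exprn_ge0 ?powR_ge0// ler_wpM2l//.
    exact: powT.
  - move=> i j ij tij.
    have /andP[ti _] := tT i; have /andP[_ tj] := tT j.
    have tij' : t i <= t j by exact: nt.
    rewrite -[X in `|X|](subrK (step (t i) (t j) (euler t y i))).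
    rewrite (le_trans (ler_normD _ _))// lerD//.
      rewrite (le_trans (HC t y nt tT i j ij tij))// ler_wpM2l// lerXn2r ?nnegrE ?powR_ge0//.
      exact: powT.
    by rewrite (le_trans (HK _ _ _ ti tij' tj))// ler_wpM2l// powT.
  - have /andP[t0 _] := tT 0%N; have /andP[_ tk] := tT k.
    by rewrite (le_trans _ nT)// (le_trans _ tk)// gerBl.
(* The radius 0 at time 0 encodes the initial condition. *)
pose Mt (t : R) := if t == 0 then 0 else M.
pose D : set (R * R) := [set q | [/\ 0 <= q.1, q.1 <= q.2, q.2 <= T & q.2 - q.1 <= delta]].
pose P (q : R * R) : set ('rV[R]_m * 'rV[R]_m) := [set v |
  `|v.2 - v.1 - step q.1 q.2 v.1| <= C * ((q.2 - q.1) `^ kappa) ^+ 3].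
have [q Dq|S|x [xM xP]] := @pointwise_compactness R m R y Mt D P.
- have [L L0 HL] := davie_step_lip kappa_gt0 kappa_le zeta_bounds sigC
    b_continuous b_bounds.
  case: Dq => s0 st tT _.
  have cstep : continuous (step q.1 q.2).
    move=> v A /nbhs_ballP[e /= e0 eA].
    have eL : 0 < e / (L + 1) by rewrite divr_gt0// ltr_wpDl.
    apply/nbhs_ballP; exists (e / (L + 1)) => //= w; rewrite -ball_normE /= => vw.
    apply: eA; rewrite -ball_normE /= distrC (le_lt_trans (HL _ _ _ _ s0 st tT))//.
    rewrite (le_lt_trans (_ : _ <= (L + 1) * `|w - v|))//.
      by rewrite ler_wpM2r// lerDl.
    by rewrite mulrC -ltr_pdivlMr ?ltr_wpDl// distrC.
  apply: (@preimage_closed _ _ (fun v : 'rV[R]_m * 'rV[R]_m =>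
      `|v.2 - v.1 - step q.1 q.2 v.1|) [set r | r <= C * ((q.2 - q.1) `^ kappa) ^+ 3]).
    move=> v _; apply: cvg_norm; apply: cvgB; first apply: cvgB.
    + exact: cvg_snd.
    + exact: cvg_fst.
    + apply: (@continuous_comp _ _ _ (fst : 'rV[R]_m * 'rV[R]_m -> 'rV[R]_m) (step q.1 q.2) v).
        exact: cvg_fst.
      exact: cstep.
  exact: closed_le.
- pose S' := [seq t <- S | 0 <= t <= T].
  have S'T t : t \in S' -> 0 <= t <= T by rewrite mem_filter => /andP[].
  have nt := time_of_nondecreasing T0 S'T.
  have tT k := time_of_bounds T0 k S'T.
  exists (fun t => euler (time_of T S') y (index_of S' t)); split.
    move=> t; rewrite /Mt; case: eqP => [->|_]; last exact: euler_bounded.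
    by rewrite index_of0 /= subrr normr0.
  move=> s t sS tS [/= s0 st t_T tsd].
  have sS' : s \in S' by rewrite mem_filter sS s0 (le_trans st).
  have tS' : t \in S' by rewrite mem_filter tS t_T (le_trans s0).
  have := HC _ y nt tT _ _ (index_of_mono T0 S'T sS' tS' st).
  by rewrite !time_of_index//; apply.
exists x, C, delta, M; split => //.
- have := xM 0; rewrite /Mt eqxx normr_le0 subr_eq0 => /eqP. exact.
- by move=> t; rewrite (le_trans (xM t))// /Mt; case: ifP.
- by move=> s t s0 st tT tsd; apply: (xP s t).
Qed.

(** For t - s > delta the bound holds with a larger constant because everything
    is bounded. *)
Lemma davie_solution (y : 'rV[R]_m) : exists2 x : R -> 'rV[R]_m, x 0 = y &
  exists2 C : R, 0 <= C & forall s t : R, 0 <= s -> s <= t -> t <= T ->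
    `|x t - x s - step s t (x s)| <= C * ((t - s) `^ kappa) ^+ 3.
Proof.
have [x [C [delta [M [C0 d0 x0 xM xC]]]]] := davie_solution_local y.
have [K K0 HK] := davie_step_bound kappa_gt0 kappa_le zeta_bounds sigC
  b_continuous b_bounds.
have M0 : 0 <= M by exact: le_trans (xM 0).
pose N := M + M + K * T `^ kappa.
have N0 : 0 <= N by rewrite !addr_ge0// mulr_ge0// powR_ge0.
have dk : 0 < (delta `^ kappa) ^+ 3 by rewrite exprn_gt0// powR_gt0.
have C'0 : 0 <= N / (delta `^ kappa) ^+ 3 by rewrite divr_ge0// ltW.
exists x => //; exists (C + N / (delta `^ kappa) ^+ 3); first exact: addr_ge0.
move=> s t s0 st tT.
have p0 : 0 <= ((t - s) `^ kappa) ^+ 3 by rewrite exprn_ge0// powR_ge0.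
have [tsd|tsd] := leP (t - s) delta.
  by rewrite (le_trans (xC s t s0 st tT tsd))// ler_wpM2r// lerDl.
apply: le_trans (_ : N <= _).
  rewrite (le_trans (ler_normB _ _))// lerD//.
    rewrite -(subrKA y) (le_trans (ler_normD _ _))// lerD//.
    by rewrite distrC.
  rewrite (le_trans (HK s t (x s) s0 st tT))// ler_wpM2l//.
  apply: (powR_le_mono kappa_gt0); first by rewrite subr_ge0.
  by rewrite (le_trans _ tT)// gerBl.
rewrite mulrDl -[leLHS]add0r lerD//; first exact: mulr_ge0.
rewrite -mulrA ler_peMr// mulrC ler_pdivlMr// mul1r.
rewrite lerXn2r ?nnegrE ?powR_ge0//.
by apply: (powR_le_mono kappa_gt0); exact: ltW.
Qed.

End euler.

(** * Rough integrals and local estimates *)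

Section rough_integral.
Context {R : realType} {d : nat} (zeta : R -> 'rV[R]_d) (zeta2 : R -> R -> 'M[R]_d).
Context (mu : R -> 'rV[R]_d) (mu' : R -> 'M[R]_d).

Definition compensated_increment (u v : R) : R :=
  \sum_(i < d) mu u 0 i * incr zeta u v 0 i +
  \sum_(i < d) \sum_(i1 < d) mu' u i i1 * zeta2 u v i1 i.

Local Notation Xi := compensated_increment.

Lemma rough_sumE s p : rough_sum zeta zeta2 mu mu' s p =
  \sum_(0 <= q < size p) Xi (nth s (s :: p) q) (nth s (s :: p) q.+1).
Proof. by []. Qed.

Lemma itv_partition_nth_bounds (s t : R) p q : itv_partition s t p ->
  (q < (size p).+1)%N -> s <= nth s (s :: p) q <= t.
Proof.
move=> st qp; have E : nth s (s :: p) q = nth t (s :: p) q by apply: set_nth_default.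
by rewrite E (itv_partition_nth_ge qp st) (itv_partition_nth_le qp st).
Qed.

Lemma itv_partition_nth_lt (s t : R) p q : itv_partition s t p ->
  (q < size p)%N -> nth s (s :: p) q < nth s (s :: p) q.+1.
Proof. by move=> [/(pathP s) sp _] qp; exact: sp. Qed.

Lemma itv_partition_telescope (s t : R) p (J : R -> R) : itv_partition s t p ->
  \sum_(0 <= q < size p) (J (nth s (s :: p) q.+1) - J (nth s (s :: p) q)) =
  J t - J s.
Proof.
move=> [_ /eqP <-].
rewrite (telescope_sumr (fun q => J (nth s (s :: p) q)))//=.
by rewrite (last_nth s).
Qed.

(** Along a partition of mesh eta the errors add up to at most C (t - s)
    eta^(theta - 1). *)
Lemma local_is_rough_integral (theta : R) (s t C : R) (J : R -> R) :
  1 < theta -> 0 <= C ->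
  (forall u v, s <= u -> u <= v -> v <= t ->
    `|J v - J u - Xi u v| <= C * (v - u) `^ theta) ->
  is_rough_integral zeta zeta2 mu mu' s t (J t - J s).
Proof.
move=> theta1 C0 HJ e e0.
have theta10 : 0 < theta - 1 by rewrite subr_gt0.
have [st|ts] := leP s t; last first.
  exists 1 => // p sp; have := itv_partition_le sp.
  by rewrite leNgt ts.
have c0 : 0 <= C * (t - s) * 2 / e by rewrite divr_ge0 ?(ltW e0)// !mulr_ge0// subr_ge0.
have [delta d0 Hd] := small_power theta10 c0.
exists delta => // p sp mesh.
rewrite rough_sumE -(itv_partition_telescope J sp) -sumrB.
apply: (@le_lt_trans _ _ (C * (t - s) * delta `^ (theta - 1))); last first.
  have : C * (t - s) * delta `^ (theta - 1) <= e / 2.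
    rewrite ler_pdivlMr//.
    have -> : C * (t - s) * delta `^ (theta - 1) * 2 =
      C * (t - s) * 2 / e * delta `^ (theta - 1) * e by field; rewrite gt_eqF.
    by rewrite ler_piMl// ltW.
  move=> /le_lt_trans; apply; rewrite ltr_pdivrMr//.
  by rewrite mulr_natr mulr2n ltrDl.
have -> : C * (t - s) * delta `^ (theta - 1) =
  \sum_(0 <= q < size p) C * delta `^ (theta - 1) *
     (nth s (s :: p) q.+1 - nth s (s :: p) q).
  by rewrite -mulr_sumr (itv_partition_telescope id sp); ring.
apply: le_trans (ler_norm_sum _ _ _) _.
rewrite big_nat [leRHS]big_nat; apply: ler_sum => q /andP[_ qp].
set u := nth s (s :: p) q; set v := nth s (s :: p) q.+1.
have /andP[su _] := itv_partition_nth_bounds sp (leqW qp).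
have /andP[_ vt] := itv_partition_nth_bounds (q := q.+1) sp qp.
have uv : u < v := itv_partition_nth_lt sp qp.
rewrite distrC (le_trans (HJ u v su (ltW uv) vt))// -mulrA ler_wpM2l//.
have uv0 : 0 <= v - u by rewrite subr_ge0 ltW.
rewrite -mulr_powRB1 ?(lt_trans _ theta1)// mulrC ler_wpM2r//.
apply: ge0_ler_powR; rewrite ?nnegrE//; [exact: ltW|exact: ltW|].
by rewrite ltW// mesh.
Qed.

(** Along every subdivision the sum of the compensated increments is within the
    sewing bound of the single compensated increment. The uniform
    subdivisions suffice to reach the limit. *)
Lemma rough_integral_local (theta K : R) (s t I : R) :
  1 < theta -> 0 <= K -> s <= t ->
  (forall u, s <= u <= t -> Xi u u = 0) ->
  (forall u v w, s <= u -> u <= v -> v <= w -> w <= t ->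
    `|Xi u w - Xi u v - Xi v w| <= K * (w - u) `^ theta) ->
  is_rough_integral zeta zeta2 mu mu' s t I ->
  `|I - Xi s t| <= sewing_constant theta K * (t - s) `^ theta.
Proof.
move=> theta1 K0 st Xi0 HK HI.
apply/ler_addgt0Pr => e e0.
have [eta eta0 Heta] := HI e e0.
move: st; rewrite le_eqVlt => /predU1P[stE|st].
  have : `|rough_sum zeta zeta2 mu mu' s [::] - I| < e.
    by apply: Heta => //; split => //=; rewrite stE.
  rewrite rough_sumE /= big_geq// sub0r normrN => /ltW.
  rewrite -stE Xi0 ?subr0 ?lexx ?stE ?lexx//.
  move=> /le_trans; apply; rewrite lerDr mulr_ge0 ?powR_ge0//.
  exact: sewing_constant_ge0.
(* A uniform subdivision of mesh h < eta. *)
pose N := (Num.bound ((t - s) / eta)).+1.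
have N0 : 0 < N%:R :> R by rewrite ltr0n.
pose h := (t - s) / N%:R.
have h0 : 0 < h by rewrite divr_gt0// subr_gt0.
have hN : N%:R * h = t - s by rewrite mulrC divfK// gt_eqF.
have heta : h < eta.
  rewrite /h ltr_pdivrMr// mulrC -ltr_pdivrMr//.
  apply: lt_le_trans (archi_boundP _) _.
    by rewrite divr_ge0 ?(ltW eta0)// subr_ge0 ltW.
  by rewrite ler_nat.
(* Constant after index N, hence always inside [s, t]. *)
pose tau k := s + (minn k N)%:R * h.
have tauS k : (k < N)%N -> tau k.+1 = tau k + h.
  move=> kN; rewrite /tau (minn_idPl kN) (minn_idPl (ltnW kN)) -natr1.
  by ring.
have tau_nd : nondecreasing_seq tau.
  move=> k l kl; rewrite /tau lerD2l ler_wpM2r ?(ltW h0)// ler_nat.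
  by rewrite leq_min geq_minr andbT (leq_trans (geq_minl _ _)).
have tau0 : tau 0 = s by rewrite /tau min0n mul0r addr0.
have tauN : tau N = t by rewrite /tau minnn hN addrC subrK.
have taus k : s <= tau k by rewrite -tau0 tau_nd.
have taut k : tau k <= t.
  by rewrite -tauN /tau minnn lerD2l ler_wpM2r ?(ltW h0)// ler_nat geq_minr.
pose p := [seq tau k.+1 | k <- iota 0 N].
have sizep : size p = N by rewrite size_map size_iota.
have nthp q : (q <= N)%N -> nth s (s :: p) q = tau q.
  case: q => [|q] qN /=; first by rewrite tau0.
  by rewrite (nth_map 0%N) ?size_iota// nth_iota.
have partp : itv_partition s t p.
  split.
    apply/(pathP s) => q; rewrite sizep => qN.
    by rewrite -[nth s p q]/(nth s (s :: p) q.+1) nthp ?(ltnW qN)// nthp// tauS// ltrDl.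
  by rewrite (last_nth s) sizep nthp// tauN.
have := Heta p partp; rewrite sizep => /(_ _)/ltW Hsum.
have {}Hsum : `|rough_sum zeta zeta2 mu mu' s p - I| <= e.
  apply: Hsum => q qN; rewrite nthp// nthp ?(ltnW qN)// tauS//.
  by rewrite addrAC subrr add0r.
pose A k l := `|\sum_(k <= q < l) Xi (tau q) (tau q.+1) - Xi (tau k) (tau l)|.
have HA : A 0%N N <= sewing_constant theta K * (tau N - tau 0%N) `^ theta.
  apply: (discrete_sewing theta1 (A := A) (delta := t - s) tau_nd K0 _ _ _ (leq0n N)).
  - by move=> k; rewrite /A big_geq// Xi0 ?subrr ?normr0// taus taut.
  - by move=> k; rewrite /A big_nat1 subrr normr0.
  - move=> k j l kj jl _ _; rewrite /A (big_cat_nat_idem (addr0 0) kj jl)//=.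
    (* Almost additivity of the sums is that of the compensated increments. *)
    have := HK _ _ _ (taus k) (tau_nd _ _ kj) (tau_nd _ _ jl) (taut l).
    set a := \sum_(k <= q < j) _; set c := \sum_(j <= q < l) _.
    move=> H; apply: le_trans (lerD (lexx _) H).
    apply: le_trans (lerD (ler_normD _ _) (lexx _)).
    rewrite [X in _ <= _ + X]distrC; apply: le_trans (ler_normD _ _).
    by rewrite le_eqVlt; apply/orP; left; apply/eqP; congr (`|_|); ring.
  - by rewrite tauN tau0.
move: HA; rewrite /A tau0 tauN => HA.
have sumE : \sum_(0 <= q < N) Xi (tau q) (tau q.+1) = rough_sum zeta zeta2 mu mu' s p.
  rewrite rough_sumE sizep big_nat [RHS]big_nat; apply: eq_bigr => q /andP[_ qN].
  by rewrite !nthp// ltnW.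
rewrite sumE in HA.
rewrite -(subrKA (rough_sum zeta zeta2 mu mu' s p)) (le_trans (ler_normD _ _))//.
by rewrite addrC lerD// distrC.
Qed.

End rough_integral.

(** * Continuity of Holder and controlled paths *)

Section continuity.
Context {R : realType} (T kappa : R).
Hypothesis kappa_gt0 : 0 < kappa.

Lemma cvg_mx {X : Type} (F : set_system X) {FF : Filter F} m n
    (f : X -> 'M[R]_(m, n)) (M : 'M[R]_(m, n)) :
  (forall i j, (fun x => f x i j) @ F --> M i j) -> f @ F --> M.
Proof.
move=> H A /nbhs_ballP[e /= e0 eA].
have H1 : \forall x \near F, forall i j, ball (M i j) e (f x i j).
  apply: filter_forall => i; apply: filter_forall => j.
  exact: (H i j _ (nbhsx_ballx _ _ e0)).
by apply: filterS H1 => x H1; apply: eA; split.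
Qed.

Lemma C1_continuous {V : normedModType R} (f : R -> V) :
  C1 T kappa f -> {within `[0, T], continuous f}.
Proof.
move=> [C HC]; apply/subspace_continuousP => t tT A /nbhs_ballP[e /= e0 eA].
have c0 : 0 <= (`|C| + 1) * 2 / e by rewrite divr_ge0 ?(ltW e0)// mulr_ge0// addr_ge0.
have [delta d0 Hd] := small_power kappa_gt0 c0.
have Cd : (`|C| + 1) * delta `^ kappa < e.
  apply: (@le_lt_trans _ _ (e / 2)); last by rewrite ltr_pdivrMr// mulr_natr mulr2n ltrDl.
  rewrite ler_pdivlMr//.
  have -> : (`|C| + 1) * delta `^ kappa * 2 =
    (`|C| + 1) * 2 / e * delta `^ kappa * e by field; rewrite gt_eqF.
  by rewrite ler_piMl// ltW.
have CC : C <= `|C| + 1 by rewrite (le_trans (ler_norm _))// lerDl.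
have key s u : 0 <= s -> s <= u -> u <= T -> u - s < delta -> `|f u - f s| < e.
  move=> s0 su uT usd; apply: le_lt_trans Cd; apply: le_trans (HC s u s0 su uT) _.
  apply: le_trans (_ : (`|C| + 1) * (u - s) `^ kappa <= _).
    by rewrite ler_wpM2r ?powR_ge0.
  rewrite ler_wpM2l ?addr_ge0//.
  by apply: powR_le_mono; rewrite ?subr_ge0// ltW.
suff : \forall s \near t, s \in `[0, T] -> A (f s) by [].
move: tT; rewrite /= in_itv/= => /andP[t0 tT].
apply/nbhs_ballP; exists delta => //= s; rewrite -ball_normE /= => ts.
rewrite in_itv/= => /andP[s0 sT]; apply: eA; rewrite -ball_normE /=.
have [st|ts'] := leP s t.
  by apply: key => //; apply: le_lt_trans ts; exact: ler_norm.
rewrite distrC; apply: key => //; first exact: ltW.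
by apply: le_lt_trans ts; rewrite distrC ler_norm.
Qed.

Lemma simplex_continuous_fst (g : R -> R) : {within `[0, T], continuous g} ->
  {within simplex T, continuous (fun p : R * R => g p.1)}.
Proof.
move=> /subspace_continuousP cg; apply/subspace_continuousP => -[s t] [/= /andP[s0 st] tT].
have sT : [set` `[0, T]] s by rewrite /= in_itv/= s0 (le_trans st).
apply: (cvg_comp _ _ _ (cg s sT)) => P nP.
have {}nP : \forall s' \near s, s' \in `[0, T] -> P s' by exact: nP.
suff : \forall p \near (s, t), simplex T p -> P p.1 by [].
have f1 : (fun p : R * R => p.1) @ (s, t) --> s by exact: (@cvg_fst _ _ (nbhs s) (nbhs t)).
have H0 : \forall p \near (s, t), p.1 \in `[0, T] -> P p.1 := f1 _ nP.
apply: filterS H0 => -[s' t'] /= H [/= /andP[s0' st'] tT'].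
by apply: H; rewrite in_itv/= s0' (le_trans st').
Qed.

Lemma simplex_continuous_snd (g : R -> R) : {within `[0, T], continuous g} ->
  {within simplex T, continuous (fun p : R * R => g p.2)}.
Proof.
move=> /subspace_continuousP cg; apply/subspace_continuousP => -[s t] [/= /andP[s0 st] tT].
have tT' : [set` `[0, T]] t by rewrite /= in_itv/= tT (le_trans s0).
apply: (cvg_comp _ _ _ (cg t tT')) => P nP.
have {}nP : \forall s' \near t, s' \in `[0, T] -> P s' by exact: nP.
suff : \forall p \near (s, t), simplex T p -> P p.2 by [].
have f2 : (fun p : R * R => p.2) @ (s, t) --> t by exact: (@cvg_snd _ _ (nbhs s) (nbhs t)).
have H0 : \forall p \near (s, t), p.2 \in `[0, T] -> P p.2 := f2 _ nP.
apply: filterS H0 => -[s' t'] /= H [/= /andP[s0' st'] tT''].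
by apply: H; rewrite in_itv/= tT'' (le_trans s0').
Qed.

Lemma C1_entry_continuous m n (f : R -> 'M[R]_(m, n)) i j : C1 T kappa f ->
  {within `[0, T], continuous (fun t => f t i j)}.
Proof.
move=> /C1_continuous/subspace_continuousP cf; apply/subspace_continuousP => t tT.
exact: (cvg_comp _ _ (cf t tT) (@coord_continuous R m n i j (f t))).
Qed.

(** The continuity of the remainder on the simplex follows from the Holder
    continuity of the paths, and its vanishing on the diagonal from the
    bound itself. *)
Lemma controlled_of_bound d (zeta : R -> 'rV[R]_d) n (z : R -> 'rV[R]_n)
    (z' : R -> 'M[R]_(n, d)) :
  C1 T kappa zeta -> C1 T kappa z -> C1 T kappa z' ->
  (exists C : R, forall s t : R, 0 <= s -> s <= t -> t <= T ->
    `|remainder zeta z z' s t| <= C * ((t - s) `^ kappa) ^+ 2) ->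
  controlled T kappa zeta z z'.
Proof.
move=> zetaC zC z'C [C HC]; split => //; split.
- apply/subspace_continuousP => p Sp.
  have c1 k l (f : R -> 'M[R]_(k, l)) i j : C1 T kappa f ->
      (fun p : R * R => f p.1 i j) @ within (simplex T) (nbhs p) --> f p.1 i j.
    move=> fC; have /subspace_continuousP := simplex_continuous_fst (@C1_entry_continuous _ _ _ i j fC).
    by apply.
  have c2 k l (f : R -> 'M[R]_(k, l)) i j : C1 T kappa f ->
      (fun p : R * R => f p.2 i j) @ within (simplex T) (nbhs p) --> f p.2 i j.
    move=> fC; have /subspace_continuousP := simplex_continuous_snd (@C1_entry_continuous _ _ _ i j fC).
    by apply.
  apply: cvg_mx => i j.
  pose r (q : R * R) := z q.2 0 j - z q.1 0 j -
    \sum_(l < d) z' q.1 j l * (zeta q.2 0 l - zeta q.1 0 l).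
  have rE q : remainder zeta z z' q.1 q.2 i j = r q.
    rewrite /r mxE /incr !mxE; congr (_ - _).
    by apply: eq_bigr => l _; rewrite !mxE.
  rewrite /from_subspace; under eq_fun do rewrite rE; rewrite rE /r.
  apply: cvgB; first exact: (cvgB (c2 _ _ _ 0 j zC) (c1 _ _ _ 0 j zC)).
  apply: (cvg_big (op := +%R)) => [|l _]; first exact: add_continuous.
  exact: (cvgM (c1 _ _ _ j l z'C) (cvgB (c2 _ _ _ 0 l zetaC) (c1 _ _ _ 0 l zetaC))).
- move=> t /andP[t0 tT]; apply/eqP; rewrite -normr_eq0 eq_le normr_ge0 andbT.
  rewrite (le_trans (HC t t t0 (lexx t) tT))// subrr powR0 ?gt_eqF//.
  by rewrite expr0n /= mulr0.
- exists C => s t s0 /ltW st tT; apply: le_trans (HC s t s0 st tT) _.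
  by rewrite (mulrC 2) powRrM powR_mulrn ?powR_ge0.
Qed.

End continuity.

(** * Existence *)

Section existence.
Context {R : realType} {m d : nat} (T kappa : R).
Hypotheses (T0 : 0 < T) (kappa3 : 3^-1 < kappa) (kappa_le : kappa <= 2^-1).
Context (zeta : R -> 'rV[R]_d) (zeta2 : R -> R -> 'M[R]_d).
Hypotheses (zetaC : C1 T kappa zeta)
  (zeta_bounds : rough_path_bounds T kappa zeta zeta2)
  (zeta_chen : chen T zeta zeta2).
Context (sigma : R -> 'rV[R]_m -> 'M[R]_(m, d)) (b : R -> 'rV[R]_m -> 'rV[R]_m).
Hypothesis sigC : forall i k, lip_diff T (sigma_entry sigma i k).
Hypothesis b_continuous : forall i,
  {within slab T, continuous (fun p : R * 'rV[R]_m => b p.1 p.2 0 i)}.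
Hypothesis b_bounds : drift_bounds T b.

Local Notation step := (davie_step zeta zeta2 sigma b).
Local Notation sig := (sigma_entry sigma).
Local Notation germ := (rough_germ zeta zeta2 sigma).

Let kappa_gt0 : 0 < kappa. Proof. by apply: lt_trans kappa3; rewrite invr_gt0. Qed.

Lemma rough_germE (x : R -> 'rV[R]_m) (x' : R -> 'M[R]_(m, d)) i (u v : R) :
  x' u = sigma u (x u) ->
  compensated_increment zeta zeta2 (sigma_path sigma x i) (sigma_path' sigma x x' i) u v
    = germ i u v (x u).
Proof.
move=> x'E; rewrite /compensated_increment /rough_germ; congr (_ + _).
  by apply: eq_bigr => k _; rewrite mxE.
apply: eq_bigr => k _; apply: eq_bigr => l _; rewrite mxE x'E; congr (_ * _).
Qed.

Definition time_pair := {q : R * R | [/\ 0 <= q.1, q.1 <= q.2 & q.2 <= T]}.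

Lemma lesssim_time_pair (F : R -> R -> R) (g : R -> R -> R) :
  (fun q : time_pair => F (sval q).1 (sval q).2) <~
    (fun q : time_pair => g (sval q).1 (sval q).2) ->
  exists C : R, forall s t : R, 0 <= s -> s <= t -> t <= T -> `|F s t| <= C * g s t.
Proof.
move=> [C _ HC]; exists C => s t s0 st tT.
have P : [/\ 0 <= (s, t).1, (s, t).1 <= (s, t).2 & (s, t).2 <= T] by [].
exact: (HC (exist _ (s, t) P)).
Qed.

Section solution.
Context (x : R -> 'rV[R]_m).
Hypothesis x_local : exists2 C : R, 0 <= C & forall s t : R, 0 <= s -> s <= t -> t <= T ->
    `|x t - x s - step s t (x s)| <= C * ((t - s) `^ kappa) ^+ 3.

Let x' t := sigma t (x t).
Let s (q : time_pair) := (sval q).1.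
Let t (q : time_pair) := (sval q).2.
Let p q := (t q - s q) `^ kappa.

Let s0 q : 0 <= s q. Proof. by case: q => -[? ?] []. Qed.
Let st q : s q <= t q. Proof. by case: q => -[? ?] []. Qed.
Let tt q : t q <= t q. Proof. by []. Qed.
Let tT q : t q <= T. Proof. by case: q => -[? ?] []. Qed.
Let p0 q : 0 <= p q. Proof. exact: powR_ge0. Qed.
Let p20 q : 0 <= p q ^+ 2. Proof. exact: exprn_ge0. Qed.
Let p1 : p <~ (fun=> 1). Proof. exact: (p_lesssim1 kappa_gt0 s0 st tt tT). Qed.
Let p2p : (fun q => p q ^+ 2) <~ p. Proof. exact: sqr_lesssim p0 p1. Qed.

Let p3p2 : (fun q => p q ^+ 3) <~ (fun q => p q ^+ 2).
Proof.
by apply: (lesssim_ext (fun q => exprS (p q) 2)); apply: lesssimMl => //; exact: lesssim_refl.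
Qed.

Lemma solution_first_order j :
  (fun q => first_order_remainder sig s (fun q => x (s q)) (fun q => x (t q))
     (fun q l => incr zeta (s q) (t q) 0 l) q 0 j) <~ (fun q => p q ^+ 2).
Proof.
apply: (first_order_remainder_lesssim kappa_gt0 kappa_le zeta_bounds sigC b_continuous
  b_bounds s0 st tt tT).
apply: lesssim_trans p3p2; have [C C0 HC] := x_local; exists C => // q.
by rewrite normr_id; exact: HC.
Qed.

Lemma solution_increment : (fun q => `|x (t q) - x (s q)|) <~ p.
Proof.
exact: (increment_lesssim sigC (times_s s0 st tt tT) p0 p1
  (zeta_lesssim_su kappa_gt0 zeta_bounds s0 st tt tT) solution_first_order).
Qed.

Let time_increment : (fun q => t q - s q) <~ p.
Proof. exact: lesssim_trans (time_increment_lesssim kappa_le s0 st tt tT) p2p. Qed.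

Lemma solution_lip f : bdd_lip T f ->
  (fun q => f (t q) (x (t q)) - f (s q) (x (s q))) <~ p.
Proof.
move=> fC; exact: (lesssim_lip fC (times_s s0 st tt tT) (times_u s0 st tt tT)
  time_increment solution_increment).
Qed.

Lemma C1_lesssim {V : normedModType R} (f : R -> V) :
  (fun q => `|f (t q) - f (s q)|) <~ p -> C1 T kappa f.
Proof.
move=> H; have [C HC] := @lesssim_time_pair (fun s t => `|f t - f s|)
  (fun s t => (t - s) `^ kappa) H.
by exists C => u v u0 uv vT; have := HC u v u0 uv vT; rewrite normr_id.
Qed.

Lemma solution_C1 : C1 T kappa x.
Proof. exact: C1_lesssim solution_increment. Qed.

Lemma solution_controlled : controlled T kappa zeta x x'.
Proof.
apply: (controlled_of_bound kappa_gt0 zetaC solution_C1).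
  apply: C1_lesssim; apply: lesssim_mx => // i j.
  have [sC _ _] := sigC i j.
  by apply: lesssim_ext (solution_lip sC) => q; rewrite !mxE.
have H : (fun q => `|remainder zeta x x' (s q) (t q)|) <~ (fun q => p q ^+ 2).
  apply: lesssim_mx => // i j; rewrite ord1.
  by apply: lesssim_ext (solution_first_order j) => q; rewrite !mxE.
have [C HC] := @lesssim_time_pair (fun s t => `|remainder zeta x x' s t|)
  (fun s t => ((t - s) `^ kappa) ^+ 2) H.
by exists C => u v u0 uv vT; have := HC u v u0 uv vT; rewrite normr_id.
Qed.

Lemma solution_sigma_controlled i :
  controlled T kappa zeta (sigma_path sigma x i) (sigma_path' sigma x x' i).
Proof.
apply: (controlled_of_bound kappa_gt0 zetaC).
- apply: C1_lesssim; apply: lesssim_mx => // i' k.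
  have [sC _ _] := sigC i k.
  by apply: lesssim_ext (solution_lip sC) => q; rewrite !mxE.
- apply: C1_lesssim; apply: lesssim_mx => // k l.
  apply: lesssim_ext (solution_lip (bdd_lip_derivative_along sigC l (sigC i k))) => q.
  by rewrite !mxE.
have H : (fun q => `|remainder zeta (sigma_path sigma x i) (sigma_path' sigma x x' i)
    (s q) (t q)|) <~ (fun q => p q ^+ 2).
  apply: lesssim_mx => // i' k; rewrite ord1.
  have := expansion_lesssim sigC (times_s s0 st tt tT) (times_u s0 st tt tT) p0 p1
    (time_increment_lesssim kappa_le s0 st tt tT)
    (zeta_lesssim_su kappa_gt0 zeta_bounds s0 st tt tT) solution_first_order (sigC i k).
  apply: lesssim_ext => q; rewrite !mxE; congr (_ - _).
  by apply: eq_bigr => l _; rewrite !mxE.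
have [C HC] := @lesssim_time_pair (fun s t => `|remainder zeta (sigma_path sigma x i)
  (sigma_path' sigma x x' i) s t|) (fun s t => ((t - s) `^ kappa) ^+ 2) H.
by exists C => u v u0 uv vT; have := HC u v u0 uv vT; rewrite normr_id.
Qed.

Let bx i (u : R) : R := b u (x u) 0 i.

Let bx_continuous i : {within `[0, T], continuous (bx i)}.
Proof. exact: (drift_continuous b_continuous (C1_continuous kappa_gt0 solution_C1)). Qed.

(** On [s, t] the solution moves by O((t - s)^kappa), so freezing it costs O((t
    - s)^(1 + kappa)), and 1 + kappa >= 3 kappa. *)
Lemma drift_frozen i :
  (fun q => \int[lebesgue_measure]_(u in `[s q, t q]) bx i u
     - drift b i (s q) (t q) (x (s q))) <~ (fun q => p q ^+ 3).
Proof.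
have [C HC] := solution_C1; have [D D0 HD] := b_bounds.
apply: (@lesssim_trans _ _ (fun q => (t q - s q) * p q)); last first.
  have := lesssimM (time_increment_lesssim kappa_le s0 st tt tT) (lesssim_refl p0).
  by apply: lesssim_extr => q; rewrite exprSr.
exists (D * `|C|); first exact: mulr_ge0.
move=> q.
have -> : D * `|C| * ((t q - s q) * p q) = D * `|C| * p q * (t q - s q) by ring.
rewrite /drift; apply: (Rintegral_dist (s0 q) (st q) (tT q) (bx_continuous (i := i))
  (@drift_continuous_cst R m T b b_continuous i (x (s q)))) => v /andP[sv vt].
have v0 := le_trans (s0 q) sv; have vT := le_trans vt (tT q).
have [|_ ] := HD i v (x v) (x (s q)); first by rewrite v0.
move=> /le_trans; apply; rewrite -mulrA ler_wpM2l//.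
apply: le_trans (HC (s q) v (s0 q) sv vT) _.
apply: le_trans (_ : `|C| * (v - s q) `^ kappa <= _).
  by rewrite ler_wpM2r ?powR_ge0// ler_norm.
by rewrite ler_wpM2l// (powR_le_mono kappa_gt0) ?subr_ge0// lerD2r.
Qed.

(** The path x - int b(u, x_u) du is additive and close to the germ, hence its
    increments are the rough integral. *)
Lemma solution_solves : solves T kappa zeta zeta2 b sigma x x'.
Proof.
split; [exact: solution_controlled|exact: solution_sigma_controlled|by []|].
move=> u v i u0 uv vT.
(* The candidate for the primitive of the rough integral. *)
pose J w := x w 0 i - \int[lebesgue_measure]_(r in `[0, w]) bx i r.
have JB w w' : 0 <= w -> w <= w' -> w' <= T ->
    J w' - J w = x w' 0 i - x w 0 i - \int[lebesgue_measure]_(r in `[w, w']) bx i r.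
  move=> w0 ww w'T.
  rewrite /J (Rintegral_chasles (lexx 0) w0 ww w'T (bx_continuous (i := i))).
  by ring.
exists (J v - J u); last by rewrite JB//; ring.
have H : (fun q => J (t q) - J (s q) - compensated_increment zeta zeta2
    (sigma_path sigma x i) (sigma_path' sigma x x' i) (s q) (t q))
    <~ (fun q => p q ^+ 3).
  apply: (@lesssim_ext _ _ _ (fun q =>
    (x (t q) - x (s q) - step (s q) (t q) (x (s q))) 0 i -
    (\int[lebesgue_measure]_(u in `[s q, t q]) bx i u
     - drift b i (s q) (t q) (x (s q))))).
    move=> q; rewrite JB// rough_germE// !mxE; ring.
  apply: lesssimB; last exact: drift_frozen.
  have [C C0 HC] := x_local; exists C => // q.
  by apply: le_trans (coord_le_norm _ _ _) _; exact: HC.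
have [C HC] := @lesssim_time_pair (fun s t => J t - J s -
  compensated_increment zeta zeta2 (sigma_path sigma x i) (sigma_path' sigma x x' i) s t)
  (fun s t => ((t - s) `^ kappa) ^+ 3) H.
apply: (@local_is_rough_integral _ _ _ _ _ _ (kappa * 3%:R) _ _ `|C|) => //.
  by rewrite -ltr_pdivrMr// mul1r.
move=> w w' uw ww w'v; rewrite (powR_theta kappa).
apply: le_trans (HC w w' (le_trans u0 uw) ww (le_trans w'v vT)) _.
by rewrite ler_wpM2r ?exprn_ge0 ?powR_ge0// ler_norm.
Qed.

End solution.

Theorem rde_existence (y : 'rV[R]_m) :
  exists (x : R -> 'rV[R]_m) (x' : R -> 'M[R]_(m, d)),
    x 0 = y /\ solves T kappa zeta zeta2 b sigma x x'.
Proof.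
have [x x0 x_local] := davie_solution T0 kappa3 kappa_le zeta_bounds zeta_chen
  sigC b_continuous b_bounds y.
by exists x, (fun t => sigma t (x t)); split => //; exact: solution_solves.
Qed.

End existence.

(** * Uniqueness *)

Section uniqueness.
Context {R : realType} {m d : nat} (T kappa : R).
Hypotheses (T0 : 0 < T) (kappa3 : 3^-1 < kappa) (kappa_le : kappa <= 2^-1).
Context (zeta : R -> 'rV[R]_d) (zeta2 : R -> R -> 'M[R]_d).
Hypotheses (zeta_bounds : rough_path_bounds T kappa zeta zeta2)
  (zeta_chen : chen T zeta zeta2).
Context (sigma : R -> 'rV[R]_m -> 'M[R]_(m, d)) (b : R -> 'rV[R]_m -> 'rV[R]_m).
Hypothesis sigC : forall i k, lip_diff T (sigma_entry sigma i k).
Hypothesis b_continuous : forall i,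
  {within slab T, continuous (fun p : R * 'rV[R]_m => b p.1 p.2 0 i)}.
Hypothesis b_bounds : drift_bounds T b.

Local Notation sig := (sigma_entry sigma).
Local Notation germ := (rough_germ zeta zeta2 sigma).
Local Notation gub i k l := (derivative_along sig (sig i k) l).

Let kappa_gt0 : 0 < kappa. Proof. by apply: lt_trans kappa3; rewrite invr_gt0. Qed.
Let theta := kappa * 3%:R.
Let theta_gt1 : 1 < theta.
Proof. by rewrite /theta -ltr_pdivrMr// mul1r. Qed.

(** For a solution, the difference between the rough integral over [s, t] and a
    single compensated increment. *)
Definition local_defect (x : R -> 'rV[R]_m) (i : 'I_m) (s t : R) : R :=
  x t 0 i - x s 0 i - \int[lebesgue_measure]_(u in `[s, t]) b u (x u) 0 i
    - germ i s t (x s).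

Lemma rough_germ_diag i (t : R) y : 0 <= t <= T -> germ i t t y = 0.
Proof.
move=> /andP[t0 tT]; have [C C0 HC] := zeta_bounds.
have [_] := HC t t t0 (lexx t) tT.
rewrite subrr powR0 ?gt_eqF// expr0n /= mulr0 normr_le0 => /eqP z20.
rewrite /rough_germ big1 ?add0r; last by move=> k _; rewrite /incr subrr mxE mulr0.
by rewrite big1// => k _; rewrite big1// => l _; rewrite z20 mxE mulr0.
Qed.

Section one_solution.
Context (x : R -> 'rV[R]_m) (x' : R -> 'M[R]_(m, d)).
Hypothesis xS : solves T kappa zeta zeta2 b sigma x x'.

Lemma solves_drift_continuous i :
  {within `[0, T], continuous (fun u => b u (x u) 0 i)}.
Proof.
have [[xC _ _] _ _ _] := xS.
exact: (drift_continuous b_continuous (C1_continuous kappa_gt0 xC)).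
Qed.

(** The additive terms cancel and the composition defect of the germ remains. *)
Lemma local_defect_chasles i (s u t : R) : 0 <= s -> s <= u -> u <= t -> t <= T ->
  local_defect x i s t - local_defect x i s u - local_defect x i u t =
  germ i s u (x s) + germ i u t (x u) - germ i s t (x s).
Proof.
move=> s0 su ut tT; rewrite /local_defect.
rewrite (Rintegral_chasles s0 su ut tT (@solves_drift_continuous i)).
by ring.
Qed.

Section elements.
Context {X : Type} (s u t : X -> R).
Hypotheses (s0 : forall q, 0 <= s q) (su : forall q, s q <= u q)
  (ut : forall q, u q <= t q) (tT : forall q, t q <= T).
Let p q := (t q - s q) `^ kappa.

(** Along a solution the first-order remainder is the remainder of the
    controlled path x. *)
Lemma solves_first_order j :
  (fun q => first_order_remainder sig s (fun q => x (s q)) (fun q => x (u q))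
     (fun q l => incr zeta (s q) (u q) 0 l) q 0 j) <~ (fun q => p q ^+ 2).
Proof.
have [[_ _ [_ rem0 [C HC]]] _ x'E _] := xS.
exists `|C| => // q.
have uT : u q <= T := le_trans (ut q) (tT q).
have -> : first_order_remainder sig s (fun q => x (s q)) (fun q => x (u q))
     (fun q l => incr zeta (s q) (u q) 0 l) q 0 j =
    remainder zeta x x' (s q) (u q) 0 j.
  rewrite !mxE; congr (_ - _); apply: eq_bigr => l _.
  by rewrite x'E// s0 (le_trans (su q)).
apply: le_trans (coord_le_norm _ _ _) _.
have := su q; rewrite le_eqVlt => /predU1P[E|suq].
  rewrite E rem0 ?normr0; last by rewrite (le_trans (s0 q) (su q)).
  by rewrite mulr_ge0// exprn_ge0// powR_ge0.
apply: le_trans (HC _ _ (s0 q) suq uT) _.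
rewrite (mulrC 2) powRrM powR_mulrn ?powR_ge0//.
apply: le_trans (_ : `|C| * ((u q - s q) `^ kappa) ^+ 2 <= _).
  by rewrite ler_wpM2r ?ler_norm// exprn_ge0// powR_ge0.
rewrite ler_wpM2l// lerXn2r ?nnegrE ?powR_ge0//.
by rewrite (powR_le_mono kappa_gt0) ?subr_ge0// lerD2r.
Qed.

End elements.

Lemma local_defect_bound : exists2 C : R, 0 <= C &
  forall i (s t : R), 0 <= s -> s <= t -> t <= T ->
  `|local_defect x i s t| <= C * ((t - s) `^ kappa) ^+ 3.
Proof.
apply: (@common_bound R m (fun i C => forall s t : R, 0 <= s -> s <= t -> t <= T ->
  `|local_defect x i s t| <= C * ((t - s) `^ kappa) ^+ 3)).
  move=> i C C' CC' H s t s0 st tT; apply: le_trans (H s t s0 st tT) _.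
  by rewrite ler_wpM2r// exprn_ge0// powR_ge0.
move=> i.
pose X := {q : R * R * R | [/\ 0 <= q.1.1, q.1.1 <= q.1.2, q.1.2 <= q.2 & q.2 <= T]}.
pose s (q : X) := (sval q).1.1; pose u (q : X) := (sval q).1.2; pose t (q : X) := (sval q).2.
have s0 q : 0 <= s q by case: q => ? [].
have su q : s q <= u q by case: q => ? [].
have ut q : u q <= t q by case: q => ? [].
have tT q : t q <= T by case: q => ? [].
have [K K0 HK] := rough_germ_defect_lesssim kappa_gt0 kappa_le zeta_bounds zeta_chen sigC
  s0 su ut tT i (fun j => solves_first_order s0 su ut tT j).
have {}HK (v w r : R) : 0 <= v -> v <= w -> w <= r -> r <= T ->
    `|germ i v w (x v) + germ i w r (x w) - germ i v r (x v)| <= K * (r - v) `^ theta.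
  move=> v0 vw wr rT.
  have P : [/\ 0 <= (v, w, r).1.1, (v, w, r).1.1 <= (v, w, r).1.2,
    (v, w, r).1.2 <= (v, w, r).2 & (v, w, r).2 <= T] by [].
  have := HK (exist _ (v, w, r) P); rewrite /theta (powR_theta kappa); exact.
exists (sewing_constant theta K) => v w v0 vw wT.
have [_ _ x'E] := xS => /(_ v w i v0 vw wT) [I HI xI].
have E r r' : v <= r -> r <= r' -> r' <= w ->
    compensated_increment zeta zeta2 (sigma_path sigma x i) (sigma_path' sigma x x' i) r r'
    = germ i r r' (x r).
  move=> vr rr' r'w; rewrite rough_germE// x'E// (le_trans v0 vr)/=.
  by rewrite (le_trans rr')// (le_trans r'w).
have := rough_integral_local theta_gt1 K0 vw _ _ HI; rewrite E//.
rewrite /theta (powR_theta kappa) -/theta => H.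
rewrite /local_defect xI [X in `|X - _|]addrAC subrr add0r; apply: H.
- move=> r /andP[vr rw]; rewrite E// rough_germ_diag//.
  by rewrite (le_trans v0 vr) (le_trans rw wT).
- move=> r r' r'' vr rr' r'r'' r''w.
  rewrite !E//; [|exact: le_trans rr'|exact: le_trans r'r'' r''w|exact: le_trans r'r''].
  have := HK r r' r'' (le_trans v0 vr) rr' r'r'' (le_trans r''w wT).
  by rewrite -normrN; apply: le_trans; rewrite le_eqVlt; apply/orP; left;
    apply/eqP; congr (`|_|); ring.
Qed.

End one_solution.

Hypothesis sigC' : forall i k j, lip_diff T (dspace (sig i k) j).

Section two_solutions.
Context (x z : R -> 'rV[R]_m) (x' z' : R -> 'M[R]_(m, d)).
Hypotheses (xS : solves T kappa zeta zeta2 b sigma x x')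
  (zS : solves T kappa zeta zeta2 b sigma z z').

Definition defect_gap i (s t : R) : R := local_defect x i s t - local_defect z i s t.

Section elements.
Context {X : Type} (s u t : X -> R) (E : X -> R).
Hypotheses (s0 : forall q, 0 <= s q) (su : forall q, s q <= u q)
  (ut : forall q, u q <= t q) (tT : forall q, t q <= T).
Let p q := (t q - s q) `^ kappa.
Hypotheses (E0 : forall q, 0 <= E q)
  (xzE : forall q r, s q <= r <= u q -> `|x r - z r| <= E q)
  (gapE : forall i, (fun q => defect_gap i (s q) (u q)) <~ (fun q => E q * p q ^+ 2)).

Let sT := times_s s0 su ut tT.
Let p0 q : 0 <= p q. Proof. exact: powR_ge0. Qed.
Let p1 : p <~ (fun=> 1). Proof. exact: (p_lesssim1 kappa_gt0 s0 su ut tT). Qed.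
Let xz_s : (fun q => `|x (s q) - z (s q)|) <~ E.
Proof. by apply: lesssim_le => q; rewrite normr_id xzE// lexx su. Qed.
Let xz_u : (fun q => `|x (u q) - z (u q)|) <~ E.
Proof. by apply: lesssim_le => q; rewrite normr_id xzE// lexx su. Qed.

Lemma drift_gap i :
  (fun q => \int[lebesgue_measure]_(r in `[s q, u q]) b r (x r) 0 i -
     \int[lebesgue_measure]_(r in `[s q, u q]) b r (z r) 0 i)
  <~ (fun q => E q * p q ^+ 2).
Proof.
apply: (@lesssim_trans _ _ (fun q => E q * (u q - s q))); last first.
  apply: lesssimM; first exact: lesssim_refl E0.
  exact: (time_increment_lesssim kappa_le s0 su ut tT).
have [C C0 HC] := b_bounds; exists C => // q; rewrite mulrA.
apply: (Rintegral_dist (s0 q) (su q) (le_trans (ut q) (tT q))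
  (solves_drift_continuous xS (i := i)) (solves_drift_continuous zS (i := i))) => r sru.
have /andP[sr ru] := sru.
have [|_ H] := HC i r (x r) (z r).
  by rewrite (le_trans (s0 q) sr) (le_trans ru)// (le_trans (ut q)).
by rewrite (le_trans H)// ler_wpM2l// xzE.
Qed.

(** The remainder consists of the drift, the area term and the local defect, and
    each of them is stable. *)
Lemma first_order_gap j :
  (fun q => first_order_remainder sig s (fun q => x (s q)) (fun q => x (u q))
     (fun q l => incr zeta (s q) (u q) 0 l) q 0 j -
   first_order_remainder sig s (fun q => z (s q)) (fun q => z (u q))
     (fun q l => incr zeta (s q) (u q) 0 l) q 0 j) <~ (fun q => E q * p q ^+ 2).
Proof.
pose area (y : R -> 'rV[R]_m) q :=
  \sum_(k < d) \sum_(l < d) gub j k l (s q) (y (s q)) * zeta2 (s q) (u q) l k.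
apply: (@lesssim_ext _ _ _ (fun q =>
  (\int[lebesgue_measure]_(r in `[s q, u q]) b r (x r) 0 j -
     \int[lebesgue_measure]_(r in `[s q, u q]) b r (z r) 0 j) +
  (area x q - area z q) + defect_gap j (s q) (u q))).
  move=> q; rewrite /defect_gap /local_defect /rough_germ -/(area x q) -/(area z q) !mxE.
  by ring.
apply: lesssimD => //; apply: lesssimD; first exact: drift_gap.
have H := area_term_lip_lesssim kappa_gt0 zeta_bounds sigC s0 su ut tT j
  (fun q => z (s q)) (fun q => x (s q)).
apply: lesssim_trans H _; apply: lesssimM xz_s _.
by apply: lesssim_refl => q; apply: exprn_ge0; exact: p0.
Qed.

Lemma defect_gap_chasles i :
  (fun q => defect_gap i (s q) (t q) - defect_gap i (s q) (u q)
     - defect_gap i (u q) (t q)) <~ (fun q => E q * p q ^+ 3).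
Proof.
have H := rough_germ_defect_difference kappa_gt0 kappa_le zeta_bounds zeta_chen sigC
  s0 su ut tT (i := i) (xi := fun q => x (s q)) (eta := fun q => x (u q))
  (xi' := fun q => z (s q)) (eta' := fun q => z (u q)) (E := E) (sigC' i)
  (fun j => solves_first_order xS s0 su ut tT j)
  (fun j => solves_first_order zS s0 su ut tT j) E0 xz_s xz_u first_order_gap.
apply: lesssim_ext H => q.
rewrite -(local_defect_chasles xS i (s0 q) (su q) (ut q) (tT q)).
rewrite -(local_defect_chasles zS i (s0 q) (su q) (ut q) (tT q)).
by rewrite /defect_gap; ring.
Qed.

Lemma gap_increment i :
  (fun q => (x (u q) - z (u q)) 0 i - (x (s q) - z (s q)) 0 i
     - defect_gap i (s q) (u q)) <~ (fun q => E q * p q).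
Proof.
apply: (@lesssim_ext _ _ _ (fun q =>
  (\int[lebesgue_measure]_(r in `[s q, u q]) b r (x r) 0 i -
     \int[lebesgue_measure]_(r in `[s q, u q]) b r (z r) 0 i) +
  (germ i (s q) (u q) (x (s q)) - germ i (s q) (u q) (z (s q))))).
  by move=> q; rewrite /defect_gap /local_defect !mxE; ring.
apply: lesssimD.
  apply: lesssim_trans (drift_gap i) _.
  exact: lesssimM (lesssim_refl E0) (sqr_lesssim p0 p1).
have H := rough_germ_lip_lesssim kappa_gt0 zeta_bounds sigC s0 su ut tT i
  (fun q => z (s q)) (fun q => x (s q)).
exact: lesssim_trans H (lesssimM xz_s (lesssim_refl p0)).
Qed.

End elements.

(** The two estimates of the uniqueness proof: the gap of local defects is
    almost additive with an error proportional to E, and it controls the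
    increments of x - z. *)
Lemma gap_estimates : exists2 K : R, 0 <= K & forall (s u t E : R),
  0 <= s -> s <= u -> u <= t -> t <= T -> 0 <= E ->
  (forall r, s <= r <= u -> `|x r - z r| <= E) ->
  (forall i, `|defect_gap i s u| <= E * ((u - s) `^ kappa) ^+ 2) ->
  (forall i, `|defect_gap i s t| <= `|defect_gap i s u| + `|defect_gap i u t| +
     K * E * ((t - s) `^ kappa) ^+ 3) /\
  (forall i, `|(x u - z u) 0 i - (x s - z s) 0 i| <= `|defect_gap i s u| +
     K * E * (t - s) `^ kappa).
Proof.
pose X := {q : (R * R) * (R * R) | [/\ 0 <= q.1.1, q.1.1 <= q.1.2, q.1.2 <= q.2.1 &
  [/\ q.2.1 <= T, 0 <= q.2.2, forall r, q.1.1 <= r <= q.1.2 -> `|x r - z r| <= q.2.2 &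
   forall i, `|defect_gap i q.1.1 q.1.2| <= q.2.2 * ((q.1.2 - q.1.1) `^ kappa) ^+ 2]]}.
pose s (q : X) := (sval q).1.1; pose u (q : X) := (sval q).1.2.
pose t (q : X) := (sval q).2.1; pose E (q : X) := (sval q).2.2.
have s0 q : 0 <= s q by case: q => ? [].
have su q : s q <= u q by case: q => ? [].
have ut q : u q <= t q by case: q => ? [].
have tT q : t q <= T by case: q => ? [? ? ? []].
have E0 q : 0 <= E q by case: q => ? [? ? ? []].
have xzE q r : s q <= r <= u q -> `|x r - z r| <= E q.
  by case: q => ? [? ? ? [? ? H ?]]; exact: H.
have gapE i : (fun q => defect_gap i (s q) (u q)) <~
    (fun q => E q * ((t q - s q) `^ kappa) ^+ 2).
  apply: lesssim_le => q.
  apply: le_trans (_ : E q * ((u q - s q) `^ kappa) ^+ 2 <= _).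
    by case: q => ? [? ? ? [? ? ? H]]; exact: H.
  rewrite ler_wpM2l// lerXn2r ?nnegrE ?powR_ge0//.
  by rewrite (powR_le_mono kappa_gt0) ?subr_ge0// lerD2r.
have [||K1 K10 HK1] := @common_bound R m (fun i K => forall q : X,
    `|defect_gap i (s q) (t q) - defect_gap i (s q) (u q) - defect_gap i (u q) (t q)|
    <= K * (E q * ((t q - s q) `^ kappa) ^+ 3)).
- move=> i K K' KK' H q; apply: le_trans (H q) _.
  by rewrite ler_wpM2r// mulr_ge0// exprn_ge0// powR_ge0.
- by move=> i; have [K _ HK] := defect_gap_chasles s0 su ut tT E0 xzE gapE i; exists K.
have [||K2 K20 HK2] := @common_bound R m (fun i K => forall q : X,
    `|(x (u q) - z (u q)) 0 i - (x (s q) - z (s q)) 0 i - defect_gap i (s q) (u q)|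
    <= K * (E q * (t q - s q) `^ kappa)).
- move=> i K K' KK' H q; apply: le_trans (H q) _.
  by rewrite ler_wpM2r// mulr_ge0// powR_ge0.
- by move=> i; have [K _ HK] := gap_increment s0 su ut tT E0 xzE i; exists K.
exists (K1 + K2); first exact: addr_ge0.
move=> s1 u1 t1 E1 s10 su1 ut1 tT1 E10 H1 H2.
have P : [/\ 0 <= ((s1, u1), (t1, E1)).1.1, ((s1, u1), (t1, E1)).1.1 <= ((s1, u1), (t1, E1)).1.2,
  ((s1, u1), (t1, E1)).1.2 <= ((s1, u1), (t1, E1)).2.1 &
  [/\ ((s1, u1), (t1, E1)).2.1 <= T, 0 <= ((s1, u1), (t1, E1)).2.2,
   forall r, ((s1, u1), (t1, E1)).1.1 <= r <= ((s1, u1), (t1, E1)).1.2 ->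
     `|x r - z r| <= ((s1, u1), (t1, E1)).2.2 &
   forall i, `|defect_gap i ((s1, u1), (t1, E1)).1.1 ((s1, u1), (t1, E1)).1.2| <=
     ((s1, u1), (t1, E1)).2.2 * ((((s1, u1), (t1, E1)).1.2 - ((s1, u1), (t1, E1)).1.1) `^ kappa) ^+ 2]].
  by split => //; split.
split=> i.
  have /= H := HK1 i (exist _ ((s1, u1), (t1, E1)) P); rewrite /s /u /t /E /= in H.
  set g := defect_gap in H *.
  have -> : g i s1 t1 = g i s1 u1 + g i u1 t1 + (g i s1 t1 - g i s1 u1 - g i u1 t1) by ring.
  rewrite (le_trans (ler_normD _ _))// lerD ?ler_normD//.
  apply: le_trans H _; rewrite -[leRHS]mulrA ler_wpM2r ?lerDl//.
  by rewrite mulr_ge0// exprn_ge0// powR_ge0.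
have /= H := HK2 i (exist _ ((s1, u1), (t1, E1)) P); rewrite /s /u /t /E /= in H.
set g := defect_gap in H *.
have -> : (x u1 - z u1) 0 i - (x s1 - z s1) 0 i = g i s1 u1 +
  ((x u1 - z u1) 0 i - (x s1 - z s1) 0 i - g i s1 u1) by ring.
rewrite (le_trans (ler_normD _ _))// lerD//.
apply: le_trans H _; rewrite -[leRHS]mulrA ler_wpM2r ?lerDr//.
by rewrite mulr_ge0// powR_ge0.
Qed.

(** The proposition P E below expresses that x - z is bounded by E and the gap
    by A E (t - s)^theta on [a, c]. Cutting at the midpoint multiplies the
    bound of the gap by sewing_ratio and adds K E (t - s)^theta, so for A
    large P E implies P (l E) with l = (1 + sewing_ratio) / 2 < 1; for delta
    small the same factor is gained for x - z, which vanishes at a. *)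
Lemma solutions_agree_locally : exists2 delta : R, 0 < delta &
  forall a t : R, 0 <= a -> x a = z a -> a <= t -> t <= T -> t - a <= delta -> x t = z t.
Proof.
have [K K0 HK] := gap_estimates.
pose ratio := sewing_ratio theta.
have ratio0 : 0 < ratio by exact: sewing_ratio_gt0.
have ratio1 : ratio < 1 by exact: sewing_ratio_lt1.
(* The summand 1 makes A positive, so that A E can dominate any initial bound. *)
pose A := sewing_constant theta K + 1.
have A1 : 1 <= A by rewrite lerDr sewing_constant_ge0.
have A0 : 0 <= A by exact: le_trans A1.
have KA : ratio * A + K <= (1 + ratio) / 2 * A.
  have -> : K = (A - 1) * (1 - ratio) / 2.
    have : 1 - ratio != 0 by rewrite subr_eq0 gt_eqF.
    by rewrite /A addrK /sewing_constant -/ratio => ?; field.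
  rewrite -subr_ge0.
  have -> : (1 + ratio) / 2 * A - (ratio * A + (A - 1) * (1 - ratio) / 2) =
    (1 - ratio) / 2 by field.
  by rewrite divr_ge0// subr_ge0 ltW.
have C0 : 0 <= 2 * (K + A) by rewrite mulr_ge0// addr_ge0.
have [delta d0 Hd] := small_power kappa_gt0 C0.
set D := delta `^ kappa in Hd.
have D0 : 0 <= D by exact: powR_ge0.
have AKD : (K + A) * D <= 2^-1.
  by rewrite -[leRHS]mul1r ler_pdivlMr// mulrC mulrA.
have AD : A * D <= 1.
  apply: le_trans (_ : (K + A) * D <= _); [by rewrite ler_wpM2r// lerDr|].
  by rewrite (le_trans AKD)// invf_le1// ler1n.
have D1 : D <= 1 by apply: le_trans AD; rewrite ler_peMl.
exists delta => // a c a0 xza ac cT cad.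
have pD (s u : R) : a <= s -> s <= u -> u <= c -> (u - s) `^ kappa <= D.
  move=> as_ su uc; apply: (powR_le_mono kappa_gt0); first by rewrite subr_ge0.
  by apply: le_trans cad; exact: lerB.
pose P E := [/\ 0 <= E, forall r, a <= r <= c -> `|x r - z r| <= E &
  forall i s u, a <= s -> s <= u -> u <= c ->
    `|defect_gap i s u| <= A * E * ((u - s) `^ kappa) ^+ 3].
have gap2 E i s u : P E -> a <= s -> s <= u -> u <= c ->
    `|defect_gap i s u| <= E * ((u - s) `^ kappa) ^+ 2.
  move=> [E0 _ H] as_ su uc; apply: le_trans (H i s u as_ su uc) _.
  rewrite (mulrC A) -mulrA ler_wpM2l// exprS mulrA ler_piMl ?exprn_ge0 ?powR_ge0//.
  by apply: le_trans AD; rewrite ler_wpM2l// pD.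
have contract E : P E -> P ((1 + ratio) / 2 * E).
  move=> PE; have [E0 HE HG] := PE.
  have l2 : 2^-1 <= (1 + ratio) / 2 by rewrite ler_pdivlMr// mulVf// lerDl ltW.
  split.
  - by rewrite mulr_ge0// (le_trans _ l2).
  - move=> r /andP[ar rc].
    have HEr v : a <= v <= r -> `|x v - z v| <= E.
      by move=> /andP[av vr]; apply: HE; rewrite av (le_trans vr).
    have [_ H] := HK a r r E a0 ar (lexx r) (le_trans rc cT) E0 HEr
      (fun i => gap2 E i a r PE (lexx a) ar rc).
    apply: mx_norm_le => [|i j]; first by rewrite mulr_ge0// (le_trans _ l2).
    rewrite ord1; have := H j; rewrite xza subrr [X in _ - X]mxE subr0 => /le_trans; apply.
    apply: le_trans (_ : (K + A) * D * E <= _).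
      have pa0 : 0 <= (r - a) `^ kappa by exact: powR_ge0.
      have pa := pD a r (lexx a) ar rc.
      have -> : (K + A) * D * E = A * E * D + K * E * D by ring.
      apply: lerD; last by rewrite ler_wpM2l// mulr_ge0.
      apply: le_trans (HG j a r (lexx a) ar rc) _.
      rewrite ler_wpM2l ?mulr_ge0//; apply: le_trans pa.
      by rewrite exprS ler_piMr// exprn_ile1// (le_trans _ D1)// pD.
    by rewrite ler_wpM2r// (le_trans AKD).
  - move=> i s t as_ st tc.
    pose u := (s + t) / 2.
    have su : s <= u by rewrite /u ler_pdivlMr// mulr_natr mulr2n lerD2l.
    have ut : u <= t by rewrite /u ler_pdivrMr// mulr_natr mulr2n lerD2r.
    have uc : u <= c by exact: le_trans tc.
    have au : a <= u by exact: le_trans su.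
    have us : u - s = (t - s) / 2 by rewrite /u; field.
    have tu : t - u = (t - s) / 2 by rewrite /u; field.
    have HEu v : s <= v <= u -> `|x v - z v| <= E.
      by move=> /andP[sv vu]; apply: HE; rewrite (le_trans as_ sv) (le_trans vu).
    have [H _] := HK s u t E (le_trans a0 as_) su ut (le_trans tc cT) E0 HEu
      (fun j => gap2 E j s u PE as_ su uc).
    apply: le_trans (H i) _.
    have h0 : 0 <= t - s by rewrite subr_ge0.
    have half := powR_half theta h0.
    have G1 := HG i s u as_ su uc; have G2 := HG i u t au ut tc.
    rewrite us -(powR_theta kappa) -/theta in G1; rewrite tu -(powR_theta kappa) -/theta in G2.
    rewrite -(powR_theta kappa) -/theta.
    apply: le_trans (lerD (lerD G1 G2) (lexx _)) _.
    have -> : A * E * ((t - s) / 2) `^ theta + A * E * ((t - s) / 2) `^ theta =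
      A * E * (ratio * (t - s) `^ theta) by rewrite -half; ring.
    have -> : A * E * (ratio * (t - s) `^ theta) + K * E * (t - s) `^ theta =
      (ratio * A + K) * (E * (t - s) `^ theta) by ring.
    have -> : A * ((1 + ratio) / 2 * E) * (t - s) `^ theta =
      (1 + ratio) / 2 * A * (E * (t - s) `^ theta) by ring.
    by rewrite ler_wpM2r// mulr_ge0// powR_ge0.
(* Some bound holds: solutions are Holder continuous and have small local
   defects. *)
have [E0 PE0] : exists E0, P E0.
  have [[[Cx HCx] _ _] _ _ _] := xS; have [[[Cz HCz] _ _] _ _ _] := zS.
  have [Dx Dx0 HDx] := local_defect_bound xS; have [Dz Dz0 HDz] := local_defect_bound zS.
  exists ((`|Cx| + `|Cz|) * D + (Dx + Dz)); split.
  - by rewrite addr_ge0 ?mulr_ge0 ?addr_ge0.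
  - move=> r /andP[ar rc]; apply: le_trans (_ : (`|Cx| + `|Cz|) * D <= _); last first.
      by rewrite lerDl addr_ge0.
    have -> : x r - z r = incr x a r - incr z a r.
      by rewrite /incr xza opprB addrA subrK.
    rewrite mulrDl (le_trans (ler_normB _ _))// lerD//.
      apply: le_trans (HCx a r a0 ar (le_trans rc cT)) _.
      apply: le_trans (_ : `|Cx| * (r - a) `^ kappa <= _).
        by rewrite ler_wpM2r ?powR_ge0// ler_norm.
      by rewrite ler_wpM2l// pD.
    apply: le_trans (HCz a r a0 ar (le_trans rc cT)) _.
    apply: le_trans (_ : `|Cz| * (r - a) `^ kappa <= _).
      by rewrite ler_wpM2r ?powR_ge0// ler_norm.
    by rewrite ler_wpM2l// pD.
  - move=> i s u as_ su uc; apply: le_trans (_ : (Dx + Dz) * ((u - s) `^ kappa) ^+ 3 <= _).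
      rewrite mulrDl (le_trans (ler_normB _ _))// lerD//.
        by apply: HDx => //; [exact: le_trans as_|exact: le_trans cT].
      by apply: HDz => //; [exact: le_trans as_|exact: le_trans cT].
    rewrite ler_wpM2r ?exprn_ge0 ?powR_ge0//.
    have H1 : 0 <= (`|Cx| + `|Cz|) * D by rewrite mulr_ge0// addr_ge0.
    apply: le_trans (_ : (`|Cx| + `|Cz|) * D + (Dx + Dz) <= _); first by rewrite lerDr.
    by rewrite ler_peMl// addr_ge0// addr_ge0.
have PN n : P (E0 * ((1 + ratio) / 2) ^+ n).
  elim: n => [|n IH]; first by rewrite expr0 mulr1.
  by have := contract _ IH; rewrite mulrCA -exprS.
have lim0 : (fun n : nat => E0 * ((1 + ratio) / 2) ^+ n) @ \oo --> (0 : R).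
  apply: cvg_geometric; rewrite ger0_norm.
    by rewrite ltr_pdivrMr// mul1r ltrD2l.
  by rewrite divr_ge0// addr_ge0// ltW.
apply/eqP; rewrite -subr_eq0 -normr_le0.
have -> : (0 : R) = lim ((fun n : nat => E0 * ((1 + ratio) / 2) ^+ n) @ \oo).
  by apply/esym/cvg_lim.
apply: limr_ge; first by apply/cvg_ex; exists 0.
by near=> n; have [_ H _] := PN n; apply: H; rewrite ac lexx.
Unshelve. all: by end_near. Qed.

Lemma solutions_agree : x 0 = z 0 -> forall t : R, 0 <= t <= T -> x t = z t.
Proof.
move=> xz0; have [delta d0 Hd] := solutions_agree_locally.
have H n (t : R) : 0 <= t -> t <= T -> t <= n%:R * delta -> x t = z t.
  elim: n t => [|n IH] t t0 tT tn.
    by have -> : t = 0 by apply/eqP; rewrite eq_le t0 andbT (le_trans tn)// mul0r.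
  have [tn'|nt] := leP t (n%:R * delta); first exact: IH.
  have n0 : 0 <= n%:R * delta by rewrite mulr_ge0// ltW.
  apply: (Hd (n%:R * delta) t n0 _ (ltW nt) tT).
    by apply: IH => //; exact: le_trans (ltW nt) tT.
  by rewrite lerBlDr (le_trans tn)// -natr1 mulrDl mul1r addrC.
move=> t /andP[t0 tT]; apply: (H (Num.bound (T / delta)) t t0 tT).
rewrite (le_trans tT)// -ler_pdivrMr//; apply/ltW/archi_boundP.
by rewrite divr_ge0// ltW.
Qed.

End two_solutions.
End uniqueness.

(** * From C_b functions and Levy areas to the bounds used above *)

Section hypotheses.
Context {R : realType} {m d : nat} (T kappa alpha : R).
Hypotheses (kappa_gt0 : 0 < kappa) (kappa_alpha : kappa <= alpha).

(** All estimates use the single exponent kappa, so the regularity of zeta and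
    zeta2 is first lowered from alpha to kappa. *)
Lemma powR_exponent_le (h : R) : 0 <= h <= T ->
  h `^ alpha <= T `^ (alpha - kappa) * h `^ kappa.
Proof.
move=> /andP[h0 hT].
have -> : h `^ alpha = h `^ (alpha - kappa) * h `^ kappa.
  by rewrite -powRD subrK// (gt_eqF (lt_le_trans kappa_gt0 kappa_alpha)).
rewrite ler_wpM2r ?powR_ge0//; apply: ge0_ler_powR; rewrite ?nnegrE ?subr_ge0//.
exact: le_trans hT.
Qed.

Lemma C1_exponent_le {V : normedModType R} (f : R -> V) :
  C1 T alpha f -> C1 T kappa f.
Proof.
move=> [C HC]; exists (`|C| * T `^ (alpha - kappa)) => s t s0 st tT.
apply: le_trans (HC s t s0 st tT) _.
apply: le_trans (_ : `|C| * (t - s) `^ alpha <= _).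
  by rewrite ler_wpM2r ?powR_ge0// ler_norm.
rewrite -mulrA ler_wpM2l// powR_exponent_le// subr_ge0 st/=.
by rewrite (le_trans _ tT)// gerBl.
Qed.

Lemma Levy_area_bounds (zeta : R -> 'rV[R]_d) zeta2 :
  C1 T alpha zeta -> Levy_area T alpha zeta zeta2 ->
  rough_path_bounds T kappa zeta zeta2.
Proof.
move=> /C1_exponent_le[C HC] [[_ z20 [D HD]] _ _].
pose c := T `^ (alpha - kappa).
have c0 : 0 <= c by exact: powR_ge0.
exists (`|C| + `|D| * c ^+ 2); first by rewrite addr_ge0// mulr_ge0// exprn_ge0.
move=> s t s0 st tT; split.
  apply: le_trans (HC s t s0 st tT) _; rewrite ler_wpM2r ?powR_ge0//.
  by rewrite (le_trans (ler_norm _))// lerDl mulr_ge0// exprn_ge0.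
move: st; rewrite le_eqVlt => /predU1P[E|st].
  rewrite E z20 ?normr0; last by rewrite tT -E s0.
  by rewrite mulr_ge0 ?exprn_ge0 ?powR_ge0// addr_ge0// mulr_ge0// exprn_ge0.
have h0 : 0 <= t - s <= T.
  by rewrite subr_ge0 ltW//= (le_trans _ tT)// gerBl.
apply: le_trans (HD s t s0 st tT) _.
rewrite (mulrC 2) powRrM powR_mulrn ?powR_ge0//.
apply: le_trans (_ : `|D| * ((t - s) `^ alpha) ^+ 2 <= _).
  by rewrite ler_wpM2r ?exprn_ge0 ?powR_ge0// ler_norm.
apply: le_trans (_ : `|D| * (c * (t - s) `^ kappa) ^+ 2 <= _).
  rewrite ler_wpM2l// lerXn2r ?nnegrE ?mulr_ge0 ?powR_ge0//.
  exact: powR_exponent_le.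
by rewrite exprMn mulrA ler_wpM2r ?exprn_ge0 ?powR_ge0// lerDr.
Qed.

Lemma Levy_area_chen (zeta : R -> 'rV[R]_d) zeta2 :
  Levy_area T alpha zeta zeta2 -> chen T zeta zeta2.
Proof.
move=> [_ H _] s u t i j s0 su ut tT.
by rewrite -(H s u t i j s0 su ut tT) /incr2 !mxE; ring.
Qed.

Lemma Cb_drift (b : R -> 'rV[R]_m -> 'rV[R]_m) :
  (forall i : 'I_m, Cb T 0 1 (fun t w => b t w 0 i)) ->
  (forall i, {within slab T, continuous (fun p : R * 'rV[R]_m => b p.1 p.2 0 i)}) /\
  drift_bounds T b.
Proof.
move=> hb; split; first by move=> i; have [[[]]] := hb i.
apply: (@common_bound R m (fun i C => forall (t : R) x y, 0 <= t <= T ->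
    `|b t x 0 i| <= C /\ `|b t x 0 i - b t y 0 i| <= C * `|x - y|)).
  move=> i C C' CC' H t x y tT; have [H1 H2] := H t x y tT.
  by split; [exact: le_trans CC'|apply: le_trans H2 _; rewrite ler_wpM2r].
move=> i; have [B HB] := Cb_bounded (hb i); have [C C0 HC] := Cb_space_lip (hb i).
exists (`|B| + C) => t x y tT; split.
  by rewrite (le_trans (HB t x tT))// (le_trans (ler_norm _))// lerDl.
by rewrite (le_trans (HC t x y tT))// ler_wpM2r// lerDr.
Qed.

End hypotheses.

Theorem proposition3p3 (R : realType) (m d : nat) (T alpha : R)
    (hT : 0 < T) (halpha : 3^-1 < alpha)
    (zeta : R -> 'rV[R]_d) (zeta2 : R -> R -> 'M[R]_d)
    (hzeta : C1 T alpha zeta) (hzeta0 : zeta 0 = 0)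
    (hzeta2 : Levy_area T alpha zeta zeta2)
    (b : R -> 'rV[R]_m -> 'rV[R]_m)
    (sigma : R -> 'rV[R]_m -> 'M[R]_(m, d))
    (hb : forall i : 'I_m, Cb T 0 1 (fun t w => b t w 0 i))
    (hsigma : forall (i : 'I_m) (k : 'I_d),
        Cb T 1 2 (fun t w => sigma t w i k))
    (y : 'rV[R]_m) (kappa : R)
    (hkappa : 3^-1 < kappa < alpha) (hkappa2 : kappa <= 2^-1) :
  (exists (x : R -> 'rV[R]_m) (x' : R -> 'M[R]_(m, d)),
      x 0 = y /\ solves T kappa zeta zeta2 b sigma x x') /\
  ((forall (i : 'I_m) (k : 'I_d), Cb T 1 3 (fun t w => sigma t w i k)) ->
   forall (x z : R -> 'rV[R]_m) (x' z' : R -> 'M[R]_(m, d)),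
     x 0 = y -> solves T kappa zeta zeta2 b sigma x x' ->
     z 0 = y -> solves T kappa zeta zeta2 b sigma z z' ->
     forall t : R, 0 <= t <= T -> x t = z t /\ x' t = z' t).
Proof.
have /andP[kappa3 /ltW kappa_alpha] := hkappa.
have kappa_gt0 : 0 < kappa by apply: lt_trans kappa3; rewrite invr_gt0.
have zetaC := C1_exponent_le kappa_gt0 kappa_alpha hzeta.
have zeta_bounds := Levy_area_bounds kappa_gt0 kappa_alpha hzeta hzeta2.
have zeta_chen := Levy_area_chen hzeta2.
have [b_continuous b_bounds] := Cb_drift hb.
have sigC i k : lip_diff T (sigma_entry sigma i k) 
  by exact: (@Cb_lip_diff _ _ _ 0 _ (hsigma i k)).
split; first exact: (rde_existence hT kappa3 hkappa2 zetaC zeta_bounds zeta_chen sigC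
  b_continuous b_bounds y).
move=> hsigma3 x z x' z' x0 xS z0 zS.
have sigC' i k j : lip_diff T (dspace (sigma_entry sigma i k) j).
  by have [_ H] := (hsigma3 i k).2 j; exact: (@Cb_lip_diff _ _ _ 0 _ H).
have xz := solutions_agree hT kappa3 hkappa2 zeta_bounds zeta_chen sigC b_continuous
  b_bounds sigC' xS zS (etrans x0 (esym z0)).
move=> t tT; have [_ _ x'E _] := xS; have [_ _ z'E _] := zS.
by rewrite x'E// z'E// xz.
Qed.
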